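(* Let $\Bbbk$ be a field of characteristic zero, $n\in\mathbb N$, and $\psi_n\colon\mathcal F_n\mathfrak b\to\Bbbk$ a Lie algebra homomorphism. If $n=0$, then $M_{\psi_0}$ is irreducible if and only if $\psi_0(\mathcal V_0)\neq0$. If $n\ge1$, then $M_{\psi_n}$ is irreducible if and only if $\psi_n(\mathcal V_{2n})\neq0$ or $\psi_n(\mathcal V_{2n-1})\neq0$.
   Context: The centreless BCCA $\mathfrak b$ is the Lie algebra with basis $\{\mathcal U_n,\mathcal V_n\mid n\ge-1\}$ and brackets $[\mathcal U_n,\mathcal U_m]=(n-m)(\mathcal U_{n+m+2}-4\mathcal U_{n+m})$, $[\mathcal U_n,\mathcal V_m]=(n-m+1)\mathcal V_{n+m+2}-4(n-m)\mathcal V_{n+m}$, $[\mathcal V_n,\mathcal V_m]=0$ (symbols with index below $-1$ interpreted as $0$); it is isomorphic to the subalgebra of the centreless BMS$_3$ algebra spanned by $L_k-L_{-k}$ ($k\ge1$) and $M_k+M_{-k}$ ($k\ge0$). For $n\in\mathbb N$, $\mathcal F_n\mathfrak b=\mathrm{span}\{\mathcal U_k,\mathcal V_k\mid k\ge n\}$. For a Lie algebra homomorphism $\psi_n\colon\mathcal F_n\mathfrak b\to\Bbbk$, let $\Bbbk_{\psi_n}=\Bbbk1_{\psi_n}$ with $x\cdot1_{\psi_n}=\psi_n(x)1_{\psi_n}$, and $M_{\psi_n}=\mathrm{Ind}_{\mathcal F_n\mathfrak b}^{\mathfrak b}\Bbbk_{\psi_n}=U(\mathfrak b)\otimes_{U(\mathcal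 F_n\mathfrak b)}\Bbbk_{\psi_n}$. *)

(* Defs.v *)
From HB Require Import structures.
From mathcomp Require Import all_boot all_order all_algebra.
Set Implicit Arguments. Unset Strict Implicit. Unset Printing Implicit Defensive.
Import Order.TTheory GRing.Theory Num.Theory.
Local Open Scope ring_scope.

(* The centreless BCCA b, given by its basis {U_k, V_k | k >= -1}.          *)
(* A basis element is encoded as a pair (isV, p) : bool * nat, where        *)
(*   (false, p) stands for U_(p-1)  and  (true, p) stands for V_(p-1).      *)
Definition gen := (bool * nat)%type.

Definition idx (x : gen) : int := (x.2)%:Z - 1.

Definition Ub (k : int) : gen := (false, absz (k + 1)).
Definition Vb (k : int) : gen := (true, absz (k + 1)).

Section Bracket.
Variable K : fieldType.

Definition lincomb := seq (K * gen).
Definition lc_scale (a : K) (c : lincomb) : lincomb :=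
  map (fun p => (a * p.1, p.2)) c.

Definition mkU (k : int) : lincomb := if k < -1 then [::] else [:: (1, Ub k)].
Definition mkV (k : int) : lincomb := if k < -1 then [::] else [:: (1, Vb k)].

Definition bracket (x y : gen) : lincomb :=
  let a := idx x in let b := idx y in
  match x.1, y.1 with
  | false, false =>
      lc_scale (a - b)%:~R (mkU (a + b + 2) ++ lc_scale (-4) (mkU (a + b)))
  | false, true =>
      lc_scale (a - b + 1)%:~R (mkV (a + b + 2))
        ++ lc_scale (-4 * (a - b))%:~R (mkV (a + b))
  | true, false =>
      lc_scale (-1) (lc_scale (b - a + 1)%:~R (mkV (a + b + 2))
        ++ lc_scale (-4 * (b - a))%:~R (mkV (a + b)))
  | true, true => [::]
  end.

(* F_n b = span{U_k, V_k | k >= n} : basis elements of F_n b *)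
Definition inF (n : nat) (x : gen) : bool := (n%:Z <= idx x).

(* A linear map F_n b -> K is determined by its values psi x on the basis
   elements x with inF n x (values of psi elsewhere are irrelevant). *)
Definition psiL (psi : gen -> K) (c : lincomb) : K :=
  \sum_(p <- c) p.1 * psi p.2.

(* psi is a Lie algebra homomorphism F_n b -> K (K abelian):
   psi [x, y] = 0 for all x, y in F_n b (checked on basis elements). *)
Definition is_lie_hom (n : nat) (psi : gen -> K) : Prop :=
  forall x y, inF n x -> inF n y -> psiL psi (bracket x y) = 0.

(* The tensor algebra T(b): finitely supported functions word -> K, where a *)
(* word [:: x1; ...; xm] stands for the monomial x1 x2 ... xm.              *)
Definition word := seq gen.
Definition tens := word -> K.

Definition fin_supp (f : tens) : Prop :=
  exists s : seq word, forall w, f w != 0 -> w \in s.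

Definition basis_t (u : word) : tens := fun w => (w == u)%:R.
Definition zero_t : tens := fun _ => 0.
Definition add_t (f h : tens) : tens := fun w => f w + h w.
Definition scale_t (a : K) (f : tens) : tens := fun w => a * f w.

Definition lmul (x : gen) (f : tens) : tens :=
  fun w => if w is y :: w' then (y == x)%:R * f w' else 0.

Definition lc_t (c : lincomb) (w : word) : tens :=
  fun u => \sum_(p <- c) p.1 * (u == p.2 :: w)%:R.

Definition left_ideal (S : tens -> Prop) : Prop :=
  [/\ forall f, S f -> fin_supp f,
      S zero_t,
      forall f h, S f -> S h -> S (add_t f h),
      forall a f, S f -> S (scale_t a f) &
      forall x f, S f -> S (lmul x f)].

(* Generators of the left ideal I_psi of T(b) with
      M_psi = U(b) (x)_{U(F_n b)} K_psi  =  T(b) / I_psi :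
   (1) (x y - y x - [x,y]) w   for basis elements x y and words w
       (these generate the two-sided ideal defining U(b) as a left ideal);
   (2) x - psi(x)              for basis elements x of F_n b. *)
Definition ind_rel (n : nat) (psi : gen -> K) (r : tens) : Prop :=
  (exists x y w, r = (fun u => basis_t [:: x, y & w] u - basis_t [:: y, x & w] u
                               - lc_t (bracket x y) w u))
  \/ (exists x, inF n x /\ r = (fun u => basis_t [:: x] u - psi x * basis_t [::] u)).

Definition ind_ideal (n : nat) (psi : gen -> K) (f : tens) : Prop :=
  forall S, left_ideal S -> (forall r, ind_rel n psi r -> S r) -> S f.

(* M_psi = T(b)/I_psi is an irreducible b-module: it is nonzero, and every
   b-submodule (= image of a left ideal S containing I_psi) is 0 or all. *)
Definition Mpsi_irreducible (n : nat) (psi : gen -> K) : Prop :=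
  (exists f, fin_supp f /\ ~ ind_ideal n psi f) /\
  forall S, left_ideal S -> (forall f, ind_ideal n psi f -> S f) ->
    (forall f, S f -> ind_ideal n psi f) \/ (forall f, fin_supp f -> S f).

End Bracket.

(* Main.v *)
(* Put [u_p = U_(p-1)] and [v_p = V_(p-1)], so that [F_n] is spanned by the
   letters with [p > n].
   The character condition forces [psi v_r = 0] for [r > 2n+1].  The theorem
   says that [M_psi] is irreducible iff some [D] in [{2n, 2n+1}] with [D > n]
   has [psi v_D <> 0].

   If there is no such [D], then [psi] extended by [v_n |-> 0] is a character of
   [F_n + K v_n], and the module induced from it is a proper nonzero quotient of
   [M_psi].  Both properness and [1 <> 0] come from a relative form of the PBW
   theorem.

   Otherwise take the largest such [D].  The matrix [psi [u_j, v_q]], with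
   [j <= n < q] and entries antitriangular along [j + q = D + 1], is invertible.
   Modulo words with fewer [u]'s, [v_q - psi v_q] acts on words in the [v]'s
   followed by words in the [u]'s through this matrix applied to the formal
   derivatives [d/du_j].  Hence an element with [m > 0] letters [u] killed by all
   [v_q - psi v_q] has derivatives of lower degree, and Euler's identity
   [sum_j u_j d/du_j = m] (characteristic 0) shows that it has itself fewer than
   [m] letters [u].  So a nonzero submodule contains a nonzero polynomial in the
   [v_j]; the same argument with [u_q - psi u_q] and [d/dv_j] then produces a
   nonzero constant. *)
Require Import Defs.
From HB Require Import structures.
From mathcomp Require Import all_boot all_order all_algebra.
From mathcomp Require Import boolp functions.
From mathcomp Require Import zify ring.
Set Implicit Arguments. Unset Strict Implicit. Unset Printing Implicit Defensive.
Import Order.TTheory GRing.Theory Num.Theory.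
Local Open Scope ring_scope.

(** * Brackets and linear combinations *)

Local Notation u_ p := ((false, p : nat) : gen).
Local Notation v_ p := ((true, p : nat) : gen).

Section BracketFormulas.
Variable K : fieldType.

(** The value at [x,y] of the linear map sending each letter [g] to [h g]. Varying [h] covers [psi
    [x,y]], the action of [x,y] and the tensor [x,y] w. *)
Definition br (V : lmodType K) (x y : gen) (h : gen -> V) : V :=
  \sum_(p <- bracket K x y) p.1 *: h p.2.

Section Module.
Variable V : lmodType K.
Implicit Types (h : gen -> V) (x y : gen).

(** For p = q = 0 the truncated predecessor names U_{-1} instead of the absent U_{-2}; the
    coefficient p - q vanishes there. The same happens in [brUV]. *)
Lemma brUU p q h : br (u_ p) (u_ q) h =
  (p%:R - q%:R) *: (h (u_ (p + q).+1) - 4 *: h (u_ (p + q).-1)).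
Proof.
rewrite /br /bracket /= /idx /= /mkU /Ub.
have -> : (p%:Z - 1 + (q%:Z - 1) + 2 < -1) = false by lia.
have -> : absz (p%:Z - 1 + (q%:Z - 1) + 2 + 1) = (p + q).+1 by lia.
have -> : (p%:Z - 1 - (q%:Z - 1))%:~R = p%:R - q%:R :> K.
  by rewrite opprB addrA subrK intrB.
case: ifP => [pq|/negbT pq] /=.
  have [-> ->] : p = 0%N /\ q = 0%N by lia.
  by rewrite big_seq1 /= subrr mul0r !scale0r.
have -> : absz (p%:Z - 1 + (q%:Z - 1) + 1) = (p + q).-1 by lia.
by rewrite big_cons big_seq1 /= !mulr1 mulrN scalerBr scalerA scaleNr.
Qed.

Lemma brUV p q h : br (u_ p) (v_ q) h =
  (p%:R - q%:R + 1) *: h (v_ (p + q).+1)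
  - (4 * (p%:R - q%:R)) *: h (v_ (p + q).-1).
Proof.
rewrite /br /bracket /= /idx /= /mkV /Vb.
have -> : (p%:Z - 1 + (q%:Z - 1) + 2 < -1) = false by lia.
have -> : absz (p%:Z - 1 + (q%:Z - 1) + 2 + 1) = (p + q).+1 by lia.
have -> : p%:Z - 1 - (q%:Z - 1) = p%:Z - q%:Z by lia.
have -> : (-4 * (p%:Z - q%:Z))%:~R = - (4 * (p%:R - q%:R)) :> K.
  by rewrite intrM intrB mulNr.
have -> : (p%:Z - q%:Z + 1)%:~R = p%:R - q%:R + 1 :> K by rewrite intrD intrB.
case: ifP => [pq|/negbT pq] /=.
  have [-> ->] : p = 0%N /\ q = 0%N by lia.
  by rewrite big_seq1 /= subrr mulr0 !scale0r subr0 mulr1.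
have -> : absz (p%:Z - 1 + (q%:Z - 1) + 1) = (p + q).-1 by lia.
by rewrite big_cons big_seq1 /= !mulr1 scaleNr.
Qed.

Lemma brVV p q h : br (v_ p) (v_ q) h = 0.
Proof. by rewrite /br big_nil. Qed.

Lemma brVU p q h : br (v_ q) (u_ p) h = - br (u_ p) (v_ q) h.
Proof.
rewrite /br /bracket /= [idx (v_ q) + _]addrC.
rewrite {1}/lc_scale big_map -scaleN1r scaler_sumr.
by apply: eq_bigr => i _; rewrite scalerA.
Qed.

Lemma brC x y h : br y x h = - br x y h.
Proof.
case: x y => -[] p [[] q]; rewrite ?brVV ?oppr0 ?brVU ?opprK //.
by rewrite !brUU addnC -[RHS]scaleNr opprB.
Qed.

Lemma brxx x h : br x x h = 0.
Proof. by case: x => -[] p; rewrite ?brVV // brUU subrr scale0r. Qed.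

Lemma br_ext x y h h' : h =1 h' -> br x y h = br x y h'.
Proof. by move=> e; apply: eq_bigr => i _; rewrite e. Qed.

Lemma brD x y h h' : br x y (fun g => h g + h' g) = br x y h + br x y h'.
Proof. by rewrite -big_split; apply: eq_bigr => i _; rewrite scalerDr. Qed.

Lemma brN x y h : br x y (fun g => - h g) = - br x y h.
Proof. by rewrite /br -sumrN; apply: eq_bigr => i _; rewrite scalerN. Qed.

Lemma brB x y h h' : br x y (fun g => h g - h' g) = br x y h - br x y h'.
Proof. by rewrite brD brN. Qed.

Lemma brZ a x y h : br x y (fun g => a *: h g) = a *: br x y h.
Proof.
by rewrite /br scaler_sumr; apply: eq_bigr => i _; rewrite !scalerA mulrC.
Qed.

End Module.

Lemma linear_comb (V W : lmodType K) I (s : seq I) (c : I -> K) (h : I -> V)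
  (f : V -> W) : linear f ->
  f (\sum_(i <- s) c i *: h i) = \sum_(i <- s) c i *: f (h i).
Proof.
move=> lf; have f0 : f 0 = 0.
  by have := lf (-1) 0 0; rewrite scaler0 add0r scaleN1r addNr.
by elim: s => [|i s IH]; rewrite ?big_nil // !big_cons lf IH.
Qed.

Lemma br_linear (V W : lmodType K) x y (f : V -> W) (h : gen -> V) :
  linear f -> f (br x y h) = br x y (fun g => f (h g)).
Proof. exact: linear_comb. Qed.

(** The Jacobi identity [x,[y,z]] - [y,[x,z]] = [[x,y],z], read through a functional [h]. *)
Lemma brJ x y z (h : gen -> K^o) :
  br y z (fun g => br x g h) - br x z (fun g => br y g h)
  = br x y (fun g => br g z h).
Proof.
case: x y z => -[] p [[] q] [[] r];
  rewrite ?brUU ?brUV ?brVU ?brUV ?brVV ?brUU ?brUV ?brVV;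
  rewrite ?brB ?brZ ?brVU ?brVV ?brUV ?(scaler0, subrr, addr0, oppr0) //.
(* Splitting each index into zero and successor makes the truncated predecessors compute. *)
all: rewrite /GRing.scale /=; move: p q r => [|p] [|q] [|r];
  rewrite ?(addn0, add0n, addnS, addSn) /= ?(addn0, add0n, addnS, addSn) /=.
all: first [ring | rewrite (addnC q p); ring | rewrite (addnC r p); ring
  | rewrite (addnC r q); ring
  | (have [E1 E2 E3 E4 E5] : [/\ q + (p + r) = p + q + r, q + (r + p) = p + q + r,
      r + (p + q) = p + q + r, r + (q + p) = p + q + r & p + r + q = p + q + r]%N;
      first by split; lia); (have E6 : (q + r + p = p + q + r)%N by lia);
    rewrite ?(addnA p) ?(E1, E2, E3, E4, E5, E6) ?(addnC q p); ring].
Qed.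
End BracketFormulas.

(** * Left multiplication by a letter in the tensor algebra *)

Section LeftMultiplication.
Variable K : fieldType.
Local Notation T := (word -> K^o).

Lemma lmul_linear x : linear (lmul x : T -> T).
Proof.
move=> a f g; apply/funext => -[|y w]; rewrite /lmul !fctE /= ?scaler0 ?addr0 //.
by rewrite mulrDr scalerAr.
Qed.

Lemma lmulZ x a (f : T) : lmul x (a *: f) = a *: lmul x f.
Proof.
by apply/funext => -[|y w]; [rewrite !fctE scaler0|exact: mulrCA].
Qed.

Lemma lmulB x (f g : T) : lmul x (f - g) = lmul x f - lmul x g.
Proof. by rewrite addrC -scaleN1r lmul_linear scaleN1r addrC. Qed.

Lemma lmulD x (f g : T) : lmul x (f + g) = lmul x f + lmul x g.
Proof. by rewrite -[f]scale1r lmul_linear !scale1r. Qed.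

Lemma lmul_sum x I (s : seq I) (h : I -> T) :
  lmul x (\sum_(i <- s) h i) = \sum_(i <- s) lmul x (h i).
Proof.
have := linear_comb s (fun=> 1) h (@lmul_linear x).
by rewrite !(eq_bigr _ (fun i _ => scale1r _)).
Qed.

Lemma lmul_basis x w : lmul x (basis_t K w) = basis_t K (x :: w).
Proof.
apply/funext => -[|y u] //=.
by rewrite /basis_t eqseq_cons -mulnb natrM.
Qed.

Lemma basis_finsupp w : fin_supp (basis_t K w).
Proof.
exists [:: w] => u; rewrite inE /basis_t.
by case: (u == w) => //=; rewrite eqxx.
Qed.
End LeftMultiplication.

(** * A relative PBW theorem *)

Section InducedPBW.
Variables (K : fieldType) (F : pred gen) (psi : gen -> K^o).
(** The span of [F] is a subalgebra, put dually so as to apply directly to functionals on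
    letters. *)
Hypothesis F_closed : forall x y (h : gen -> K^o), F x -> F y ->
  (forall g, F g -> h g = 0) -> br x y h = 0.
Hypothesis psi_hom : forall x y, F x -> F y -> br x y psi = 0.
Local Notation T := (word -> K^o).
Implicit Types (x y z : gen) (I J : word) (phi : T).

Definition code x := (x.2.*2 + x.1)%N.
(** Letters of [F] come last: in a sorted monomial they stand next to the generator, where they act
    by [psi]. *)
Definition pbw_le x y := if F x == F y then (code x <= code y)%N else F y.
Local Notation le := pbw_le.

Lemma code_inj : injective code.
Proof.
move=> [[] p] [[] q]; rewrite /code /= -!muln2 => e;
  first [exfalso; lia | by congr (_, _); lia].
Qed.

Lemma pbw_le_total x y : le x y || le y x.
Proof.
rewrite /le; case: (F x) (F y) => -[] //=; exact: leq_total.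
Qed.

Lemma pbw_le_trans y x z : le x y -> le y z -> le x z.
Proof.
rewrite /le; case: (F x) (F y) (F z) => -[] [] //=; exact: leq_trans.
Qed.

Lemma pbw_le_anti x y : le x y -> le y x -> x = y.
Proof.
rewrite /le; case: (F x) (F y) => -[] //= xy yx;
  by apply: code_inj; apply/eqP; rewrite eqn_leq xy.
Qed.

Fixpoint ins x I : word :=
  if I is y :: J then if le x y then x :: I else y :: ins x J else [:: x].

(** Sorted words in the letters outside [F]: they index the PBW basis of the module induced from
    [psi]. *)
Fixpoint normal I : bool :=
  if I is y :: J then [&& ~~ F y, all (le y) J & normal J] else true.

Lemma size_ins x I : size (ins x I) = (size I).+1.
Proof. by elim: I => //= y J IH; case: ifP => //= _; rewrite IH. Qed.

Lemma all_ins (a : pred gen) x I : all a (ins x I) = a x && all a I.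
Proof. by elim: I => //= y J IH; case: ifP => //= _; rewrite IH andbCA. Qed.

Lemma ins_normal x I : ~~ F x -> normal I -> normal (ins x I).
Proof.
move=> Fx; elim: I => [|y J IH] /=; first by rewrite Fx.
case/and3P=> Fy yJ nJ; case: ifP => xy /=.
  rewrite Fx Fy yJ nJ xy /= andbT.
  by apply: sub_all yJ => z; exact: pbw_le_trans.
rewrite Fy all_ins yJ IH // !andbT.
by have := pbw_le_total x y; rewrite xy.
Qed.

(* The action is described on the dual side: [act x phi I] is the value of
   [phi] at [x . z_I].  Here [z_I] runs over the PBW basis, [ins x I] is the
   leading term of [x . z_I], and [rem] collects the terms of length at most
   [size I]; the first argument of [rem] is fuel. *)
Definition act_with (r : T -> T) x phi : T :=
  fun I => (if F x then 0 else phi (ins x I)) + r phi I.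

Fixpoint rem p x phi I {struct p} : K^o :=
  match I with
  | [::] => if F x then psi x * phi [::] else 0
  | y :: J => if ~~ F x && le x y then 0 else
      if p is p'.+1 then
        rem p' x (act_with (rem p' y) y phi) J
        + br x y (fun g => act_with (rem p' g) g phi J)
      else 0
  end.

Lemma rem_cons p x phi y J : rem p.+1 x phi (y :: J) =
  if ~~ F x && le x y then 0 else
    rem p x (act_with (rem p y) y phi) J
    + br x y (fun g => act_with (rem p g) g phi J).
Proof. by []. Qed.

Definition act x phi : T := fun I => act_with (rem (size I) x) x phi I.

(** The remainder of [x . z_I] is no longer than [I], so only values of [phi] on such words enter.
    This locality is what makes the fuel irrelevant. *)
Lemma rem_ext p x phi phi' I : normal I ->
  (forall J, normal J -> (size J <= size I)%N -> phi J = phi' J) ->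
  rem p x phi I = rem p x phi' I.
Proof.
elim: p x phi phi' I => [|p IH] x phi phi' [|y J] //=; try by move=> _ ->.
case/and3P=> Fy yJ nJ e; case: ifP => // _.
have E z L : normal L -> (size L <= size J)%N ->
    act_with (rem p z) z phi L = act_with (rem p z) z phi' L.
  move=> nL sL; congr (_ + _).
    case: ifPn => // Fz; apply: e; rewrite ?size_ins //.
    exact: ins_normal.
  by apply: IH => // M nM sM; apply: e => //; lia.
congr (_ + _); last by apply: br_ext => g; exact: E.
by apply: IH => // M nM sM; exact: E.
Qed.

Lemma rem_linear p x : linear (rem p x : T -> T).
Proof.
elim: p x => [|p IH] x a phi phi'; apply/funext => -[|y J] /=;
  rewrite !fctE /=; case: ifP => _; rewrite ?scaler0 ?addr0 //.
1,2: by rewrite mulrDr; congr (_ + _); exact: mulrCA.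
have E z : act_with (rem p z) z (a *: phi + phi') =
    a *: act_with (rem p z) z phi + act_with (rem p z) z phi'.
  apply/funext => L; rewrite /act_with !fctE IH !fctE.
  by case: (F z); rewrite ?add0r // scalerDr addrACA.
by rewrite E IH (br_ext _ _ (fun g => congr1 (@^~ J) (E g))) !fctE brD brZ
  scalerDr addrACA.
Qed.

Lemma rem_fuel p x phi I : normal I -> (size I <= p)%N ->
  rem p.+1 x phi I = rem p x phi I.
Proof.
elim: p x phi I => [|p IH] x phi [|y J] // /and3P[Fy yJ nJ] sJ.
rewrite !rem_cons; case: ifP => // _.
have E z L : normal L -> (size L <= size J)%N ->
    act_with (rem p.+1 z) z phi L = act_with (rem p z) z phi L.
  by move=> nL sL; rewrite /act_with IH //; exact: leq_trans sL sJ.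
congr (_ + _); last by apply: br_ext => g; exact: E.
rewrite (IH x _ J nJ) //; apply: rem_ext => // L nL sL; exact: E.
Qed.

Lemma act_fuel p x phi I : normal I -> (size I <= p)%N ->
  act_with (rem p x) x phi I = act x phi I.
Proof.
move=> nI; elim: p => [|p IH]; first by case: I nI.
rewrite leq_eqVlt => /orP[/eqP<- //|]; rewrite ltnS => sI.
by rewrite -IH // /act_with rem_fuel.
Qed.

Lemma act_ext x phi phi' I : normal I ->
  (~~ F x -> phi (ins x I) = phi' (ins x I)) ->
  (forall J, normal J -> (size J <= size I)%N -> phi J = phi' J) ->
  act x phi I = act x phi' I.
Proof.
move=> nI e1 e2; congr (_ + _); first by case: ifPn.
exact: rem_ext.
Qed.

Lemma act_linear x : linear (act x : T -> T).
Proof.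
move=> a phi phi'; apply/funext => I; rewrite /act /act_with rem_linear !fctE.
by case: (F x); rewrite ?add0r // scalerDr addrACA.
Qed.

Lemma act_add x phi phi' I :
  act x (fun L => phi L + phi' L) I = act x phi I + act x phi' I.
Proof.
have := act_linear x 1 phi phi'; rewrite !scale1r => /(congr1 (fun f : T => f I)).
by [].
Qed.

Lemma act_nil x phi : F x -> act x phi [::] = psi x * phi [::].
Proof. by move=> Fx; rewrite /act /act_with /= Fx add0r. Qed.

Lemma act_low y phi I : ~~ F y -> all (le y) I -> act y phi I = phi (y :: I).
Proof.
rewrite /act /act_with; case: I => [|z J] /= Fy; rewrite (negbTE Fy) ?addr0 //=.
by case/andP=> -> _ /=; rewrite addr0.
Qed.

(** The recursion x y z_J = y x z_J + [x,y] z_J without fuel. Operators on functionals compose in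
    the reverse order. *)
Lemma act_high x y phi J : normal (y :: J) -> F x || ~~ le x y ->
  act x phi (y :: J) = act x (act y phi) J + br x y (fun g => act g phi J).
Proof.
case/and3P=> Fy yJ nJ xy.
have xyF : ~~ F x && le x y = false by apply: negbTE; rewrite negb_and negbK.
rewrite {1}/act {1}/act_with /= xyF addrA; congr (_ + _).
rewrite /act {1}/act_with; congr (_ + _).
  case: ifPn xy => //= Fx /negbTE xy; rewrite xy.
  rewrite -/(act y phi _) act_low // all_ins yJ andbT.
  by have := pbw_le_total x y; rewrite xy.
by apply: rem_ext => // L nL sL; exact: act_fuel.
Qed.

Local Opaque act.

Lemma act_comm_low x y phi I : normal (y :: I) -> F x || ~~ le x y ->
  act y (act x phi) I = act x (act y phi) I + br x y (fun g => act g phi I).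
Proof.
by move=> nyI xy; rewrite -act_high // act_low //; case/and3P: nyI.
Qed.

Lemma act_br y x z phi J :
  act y (fun L => br x z (fun g => act g phi L)) J =
  br x z (fun g => act y (act g phi) J).
Proof.
have E : (fun L => br x z (fun g => act g phi L)) = br x z (fun g => act g phi : T).
  apply/funext => L.
  by rewrite (br_linear _ _ _ (f := fun f : T => f L)).
rewrite E (br_linear _ _ _ (@act_linear y)).
by rewrite (br_linear _ _ _ (f := fun f : T => f J)).
Qed.

(** Induction on the length of [I]. If [x] or [y] can be put in front of [I], the relation is the
    recursion defining the action. If not and [I] is empty, both letters lie in [F] and [psi_hom]
    applies. Otherwise the first letter of [I] precedes both, and everything reduces to shorter
    words. *)
Lemma act_comm I : normal I -> forall x y phi,
  act y (act x phi) I - act x (act y phi) I = br x y (fun g => act g phi I).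
Proof.
have [m] := ubnP (size I); elim: m I => // m IHm I sI nI x y phi.
have low x' y' : normal (y' :: I) -> F x' || ~~ le x' y' ->
    act y' (act x' phi) I - act x' (act y' phi) I = br x' y' (fun g => act g phi I).
  by move=> ny xy'; rewrite (act_comm_low phi ny xy') addrC addKr.
have [nyI|nyI] := boolP (normal (y :: I)).
  have [->|xy] := eqVneq x y; first by rewrite brxx subrr.
  have [le_xy|lt] := boolP (~~ F x && le x y); last first.
    by apply: low => //; move: lt; rewrite negb_and negbK.
  have nxI : normal (x :: I).
    case/andP: le_xy => Fx xy'; case/and3P: nyI => Fy yI _ /=.
    by rewrite Fx nI andbT; apply: sub_all yI => w; exact: pbw_le_trans.
  rewrite -opprB low // -?brC //; apply/orP; right; apply/negP => yx.
  by case/andP: le_xy => _ /pbw_le_anti /(_ yx) /eqP; rewrite (negbTE xy).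
have [nxI|nxI] := boolP (normal (x :: I)).
  rewrite -opprB low // -?brC //.
  rewrite -implyNb; apply/implyP=> Fy; apply/negP => yx; case/negP: nyI.
  rewrite /= Fy nI andbT; case/and3P: nxI => Fx xI _.
  by apply: sub_all xI => w; exact: pbw_le_trans.
case: I sI nI nxI nyI {low} => [|z J] sI nI nxI nyI.
  move: nxI nyI; rewrite /= !andbT !negbK => Fx Fy.
  rewrite !act_nil // mulrCA subrr.
  (* On [F] the functional [act g phi [::]] agrees with [phi [::] * psi g], and [psi] kills
     [x,y]. *)
  have := @brZ K K^o (phi [::]) x y psi; rewrite psi_hom // scaler0 => <-.
  apply/eqP; rewrite -subr_eq0 -brB; apply/eqP.
  apply: F_closed => // g Fg; rewrite act_nil //.
  by rewrite /GRing.scale /= mulrC subrr.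
move: (nI) => /= /and3P[Fz zJ nJ].
have big w : ~~ normal (w :: z :: J) -> F w || ~~ le w z.
  rewrite -implyNb => nw; apply/implyP => Fw; apply: contra nw => wz.
  rewrite /= Fw Fz zJ nJ wz !andbT /=.
  by apply: sub_all zJ => t; exact: pbw_le_trans.
have {}IHm L : normal L -> (size L <= size J)%N -> forall x y phi,
    act y (act x phi) L = act x (act y phi) L + br x y (fun g => act g phi L).
  move=> nL sL x' y' phi'; apply/eqP; rewrite [eqbRHS]addrC -subr_eq; apply/eqP.
  by apply: IHm => //; exact: leq_ltn_trans sL sI.
(* Both products are expanded through the least letter [z]; the double brackets
   cancel by the Jacobi identity. *)
have key x' y' : F x' || ~~ le x' z -> F y' || ~~ le y' z ->
    act y' (act x' phi) (z :: J) =
    act y' (act x' (act z phi)) J + br x' z (fun g => act y' (act g phi) J)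
    + br y' z (fun g => act x' (act g phi) J)
    + br y' z (fun g => br x' g (fun g' => act g' phi J)).
  move=> bx by'; rewrite act_high //.
  rewrite -[RHS]addrA; congr (_ + _); last first.
    by rewrite -(@brD K K^o); apply: br_ext => g; rewrite IHm.
  rewrite -act_br -act_add.
  apply: act_ext => // [Fy|L nL sL]; last by rewrite IHm.
  rewrite act_comm_low //= Fz ins_normal // all_ins zJ !andbT /=.
  by move: by'; rewrite (negbTE Fy) /= => yz; have := pbw_le_total y' z; rewrite (negbTE yz).
rewrite !key ?big //.
have -> : br x y (fun g => act g phi (z :: J)) =
    br x y (fun g => act g (act z phi) J) + br x y (fun g => br g z (fun g' => act g' phi J)).
  by rewrite -(@brD K K^o); apply: br_ext => g; rewrite -IHm // [RHS]act_low.
rewrite -brJ (IHm J nJ (leqnn _) x y).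
set a := act x _ _; set b := br x y _; set c := br x z _; set d := br y z _.
set e := br y z _; set f := br x z _.
ring.
Qed.

(** The value of [phi] at the word [w] applied to the generator of the constructed module. *)
Fixpoint ev phi w : K^o := if w is x :: w' then ev (act x phi) w' else phi [::].

Lemma ev_ext phi phi' w : (forall I, normal I -> phi I = phi' I) ->
  ev phi w = ev phi' w.
Proof.
elim: w phi phi' => [|x w IH] phi phi' e /=; first exact: e.
apply: IH => I nI; apply: act_ext => // [Fx|J nJ _]; last exact: e.
by apply: e; exact: ins_normal.
Qed.

Lemma ev_linear w : linear (ev^~ w).
Proof.
elim: w => [|x w IH] a phi phi' //=.
by rewrite act_linear IH.
Qed.

Lemma ev_normal phi w : normal w -> ev phi w = phi w.
Proof.
by elim: w phi => //= x w IH phi /and3P[Fx xw nw]; rewrite IH // act_low.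
Qed.

(** The annihilator of the generator: the tensors on which every functional evaluates to 0. An
    explicit combination of words is carried along because [ev] is defined on words only. *)
Definition pbw_ideal (f : T) : Prop := exists s : seq (K * word),
  f = \sum_(p <- s) p.1 *: (basis_t K p.2 : T) /\
  forall phi, \sum_(p <- s) p.1 * ev phi p.2 = 0.

Lemma pbw_ideal_left : left_ideal pbw_ideal.
Proof.
split.
- move=> f [s [-> _]]; exists (map snd s) => w; apply: contra_neqT => ws.
  rewrite fct_sumE big1_seq // => p /= ps; transitivity (p.1 * (w == p.2)%:R) => //.
  have -> : (w == p.2) = false.
    by apply/negbTE; apply: contra ws => /eqP->; exact: map_f.
  by rewrite mulr0.
- by exists [::]; split=> [|phi]; rewrite big_nil.
- move=> _ _ [s [-> sE]] [t [-> tE]]; exists (s ++ t); split=> [|phi].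
    by rewrite big_cat.
  by rewrite big_cat /= sE tE addr0.
- move=> a _ [s [-> sE]]; exists [seq (a * p.1, p.2) | p <- s].
  split=> [|phi]; rewrite big_map.
    transitivity (a *: (\sum_(p <- s) p.1 *: (basis_t K p.2 : T))) => //.
    by rewrite scaler_sumr; apply: eq_bigr => p _; rewrite scalerA.
  transitivity (a * \sum_(p <- s) p.1 * ev phi p.2); last by rewrite sE mulr0.
  by rewrite mulr_sumr; apply: eq_bigr => p _; rewrite mulrA.
- move=> x _ [s [-> sE]]; exists [seq (p.1, x :: p.2) | p <- s].
  split=> [|phi]; rewrite big_map; last exact: sE (act x phi).
  rewrite (linear_comb _ _ _ (@lmul_linear K x)).
  by apply: eq_bigr => p _; rewrite lmul_basis.
Qed.

Lemma pbw_ideal_ind (n : nat) (psi0 : gen -> K) r :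
  (forall x, inF n x -> F x /\ psi x = psi0 x) ->
  ind_rel n psi0 r -> pbw_ideal r.
Proof.
move=> FE [[x [y [w ->]]]|[x [Fx ->]]].
  exists ([:: (1, [:: x, y & w]); (-1, [:: y, x & w])] ++
          [seq (- p.1, p.2 :: w) | p <- bracket K x y]).
  split=> [|phi]; rewrite big_cat !big_cons big_nil big_map /=.
    apply/funext => u; rewrite !fctE fct_sumE /lc_t addr0 scale1r scaleN1r.
    congr (_ + _); rewrite -sumrN; apply: eq_bigr => p _.
    by rewrite !fctE scaleNr.
  rewrite mul1r mulN1r addr0.
  transitivity (ev (act y (act x phi) - act x (act y phi)
     - br x y (fun g => act g phi : T)) w).
    have evB f g : ev (f - g) w = ev f w - ev g w.
      by rewrite addrC -scaleN1r ev_linear scaleN1r addrC.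
    rewrite !evB; congr (_ + _).
    rewrite (br_linear _ _ _ (f := fun f : T => ev f w)); last exact: ev_linear.
    rewrite /br -sumrN; apply: eq_bigr => p _; rewrite mulNr.
    by [].
  transitivity (ev 0 w).
    apply: ev_ext => I nI; rewrite !fctE act_comm //.
    by rewrite (br_linear _ _ _ (f := fun f : T => f I)) // subrr.
  by have := ev_linear w (-1) 0 0; rewrite scaler0 add0r scaleN1r addNr.
have [F'x <-] := FE x Fx.
exists [:: (1, [:: x]); (- psi x, [::])].
rewrite !big_cons !big_nil /= addr0; split=> [|phi].
  by apply/funext => u; rewrite !fctE scale1r scaleNr.
by rewrite big_cons big_seq1 /= act_nil // mul1r mulNr subrr.
Qed.

(** Words are linearly independent, so evaluating a tensor does not depend on how it is written as a
    combination of words. *)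
Lemma lincomb_basis_eq0 (s : seq (K * word)) (h : word -> K) :
  \sum_(p <- s) p.1 *: (basis_t K p.2 : T) = 0 ->
  \sum_(p <- s) p.1 * h p.2 = 0.
Proof.
move=> s0; pose W := undup (map snd s).
transitivity (\sum_(p <- s) \sum_(w <- W) p.1 * (w == p.2)%:R * h w).
  rewrite !big_seq; apply: eq_bigr => p ps.
  rewrite (bigD1_seq p.2) ?undup_uniq //=; last by rewrite mem_undup map_f.
  rewrite eqxx mulr1 big1 ?addr0 // => w /negbTE ->.
  by rewrite mulr0 mul0r.
rewrite exchange_big big1 // => w _; rewrite -mulr_suml.
have := congr1 (fun f : T => f w) s0.
by rewrite fct_sumE => /= ->; rewrite mul0r.
Qed.

(** Linear independence in PBW: the coordinate functional of [w] takes the value 1 on [w]. *)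
Lemma pbw_ideal_normal w : normal w -> ~ pbw_ideal (basis_t K w).
Proof.
move=> nw [s [sw sE]]; pose phi : T := fun u => (u == w)%:R.
have /lincomb_basis_eq0 : \sum_(p <- (-1, w) :: s) p.1 *: (basis_t K p.2 : T) = 0.
  by rewrite big_cons -sw scaleN1r addNr.
move=> /(_ (ev phi)); rewrite big_cons sE addr0 /= mulN1r => /eqP.
have -> : ev phi w = 1.
  by rewrite ev_normal // /phi eqxx.
by rewrite oppr_eq0 oner_eq0.
Qed.

End InducedPBW.

(** * The degenerate case *)

Section Characters.
Variables (K : fieldType) (n : nat) (psi : gen -> K).
Hypothesis charK0 : [pchar K] =i pred0.
Hypothesis psi_hom : is_lie_hom n psi.

Lemma natK_eq0 m : (m%:R == 0 :> K) = (m == 0)%N.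
Proof. exact: (pcharf0P K).1 charK0 m. Qed.

Lemma natB_neq0 p q : p != q -> p%:R - q%:R != 0 :> K.
Proof.
rewrite subr_eq0; apply: contra => /eqP pq.
have [le_pq|/ltnW le_qp] := leqP p q.
  have := natK_eq0 (q - p); rewrite natrB // pq subrr eqxx => /esym; lia.
have := natK_eq0 (p - q); rewrite natrB // pq subrr eqxx => /esym; lia.
Qed.

Lemma inFE x : inF n x = (n < x.2)%N.
Proof. by rewrite /inF /idx; lia. Qed.

Lemma psi_br x y : (n < x.2)%N -> (n < y.2)%N -> br x y (psi : gen -> K^o) = 0.
Proof. by move=> nx ny; apply: psi_hom; rewrite inFE. Qed.

(** For r = 2k+1 one has [u_k, v_k] = v_r, and for r = 2k one has [u_k, v_{k+1}] = 4 v_r. In both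
    cases k > n, so the bracket is taken inside F_n. *)
Lemma psi_V_eq0 r : (2 * n + 1 < r)%N -> psi (v_ r) = 0.
Proof.
move=> nr; have [odd_r|even_r] := boolP (odd r).
  have -> : r = (r./2 + r./2).+1 by lia.
  have := @psi_br (u_ r./2) (v_ r./2).
  rewrite brUV /= subrr add0r mulr0 scale0r subr0 scale1r; apply; lia.
have E : (r./2 + r./2.+1).-1 = r by lia.
have := @psi_br (u_ r./2) (v_ r./2.+1).
rewrite brUV E /= -natr1 opprD addrA subrr add0r addNr scale0r sub0r mulrN1.
rewrite scaleNr opprK => /(_ _ _)/eqP; rewrite scaler_eq0 natK_eq0 /=.
by move=> e; apply/eqP; apply: e; lia.
Qed.

Lemma above_closed x y (h : gen -> K^o) : (n < x.2)%N -> (n < y.2)%N ->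
  (forall g, (n < g.2)%N -> h g = 0) -> br x y h = 0.
Proof.
case: x y => -[] p [[] q] /= np nq h0;
  rewrite ?brVV ?brVU ?brUV ?brUU // !h0 /=; try lia;
  by rewrite !scaler0 subr0 ?oppr0 ?scaler0.
Qed.

Section Degenerate.
Hypothesis psi0 : forall r, (n < r)%N -> (2 * n <= r)%N -> psi (v_ r) = 0.

(** The letters of F_n + K v_n: the bound is n for a [v] and n+1 for a [u]. *)
Definition above' (x : gen) := (n + ~~ x.1 <= x.2)%N.
Definition psi' (x : gen) : K^o := if x == v_ n then 0 else psi x.

Lemma psi'V r : (n <= r)%N -> (2 * n <= r)%N -> psi' (v_ r) = 0.
Proof.
move=> nr n2r; rewrite /psi'; case: eqP => // vr; apply: psi0 => //.
by rewrite ltn_neqAle nr andbT; apply/eqP => nE; rewrite nE in vr.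
Qed.

Lemma above'_closed x y (h : gen -> K^o) : above' x -> above' y ->
  (forall g, above' g -> h g = 0) -> br x y h = 0.
Proof.
rewrite /above'; case: x y => -[] p [[] q] /= np nq h0;
  rewrite ?brVV ?brVU ?brUV ?brUU // !h0 /=; try lia;
  by rewrite !scaler0 subr0 ?oppr0 ?scaler0.
Qed.

Lemma psi'_hom x y : above' x -> above' y -> br x y psi' = 0.
Proof.
rewrite /above'; case: x y => -[] p [[] q] /= np nq; rewrite ?brVV ?brVU //.
- by rewrite brUV !psi'V ?scaler0 ?subr0 ?oppr0 //; lia.
- by rewrite brUV !psi'V ?scaler0 ?subr0 ?oppr0 //; lia.
have := @psi_br (u_ p) (u_ q); rewrite !brUU /psi' /=; apply; lia.
Qed.

Lemma degenerate_reducible : ~ Mpsi_irreducible n psi.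
Proof.
pose S := pbw_ideal above' psi'.
have S_left : left_ideal S := pbw_ideal_left above' psi'.
case=> _ /(_ S S_left)[].
- move=> f /(_ S S_left); apply=> r.
  apply: (pbw_ideal_ind above'_closed psi'_hom) => x.
  rewrite inFE /above' /psi' => nx; split; first by case: (x.1); lia.
  by case: eqP nx => // -> /=; rewrite ltnn.
(* The vector v_n is killed in the quotient since [psi'] vanishes on it, yet it belongs to the PBW
   basis of the module induced from F_n. *)
- move=> SI; have Sv : S (basis_t K [:: v_ n]).
    exists [:: (1, [:: v_ n])]; rewrite big_seq1 scale1r; split=> // phi.
    by rewrite big_seq1 /= act_nil /psi' ?eqxx ?mul0r ?mulr0 // /above' /= addn0.
  pose above (x : gen) := (n < x.2)%N.
  have : pbw_ideal above (psi : gen -> K^o) (basis_t K [:: v_ n]).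
    apply: (SI _ Sv); first exact: pbw_ideal_left.
    move=> r; apply: (@pbw_ideal_ind _ above _ above_closed psi_br) => x.
    by rewrite inFE.
  apply: pbw_ideal_normal.
  by rewrite /= /above /= ltnn.
- move=> /(_ _ (basis_finsupp K [::])).
  exact: pbw_ideal_normal.
Qed.
End Degenerate.
End Characters.

(** * Subspaces of the tensor algebra and formal derivatives *)

Section Subspaces.
Variable K : fieldType.
Local Notation T := (word -> K^o).
Implicit Types (f g : T) (N : T -> Prop) (x y : gen) (w : word).

Definition subspace N := [/\ N 0, forall f g, N f -> N g -> N (f + g) &
  forall a f, N f -> N (a *: f)].

Section Closure.
Variables (N : T -> Prop) (N_sub : subspace N).

Lemma sub0 : N 0. Proof. by case: N_sub. Qed.
Lemma subD f g : N f -> N g -> N (f + g). Proof. by case: N_sub => _ h _; exact: h. Qed.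
Lemma subZ a f : N f -> N (a *: f). Proof. by case: N_sub => _ _; apply. Qed.
Lemma subN f : N f -> N (- f). Proof. by rewrite -scaleN1r; exact: subZ. Qed.
Lemma subB f g : N f -> N g -> N (f - g).
Proof. by move=> Nf Ng; apply: subD => //; exact: subN. Qed.
Lemma sub_trans f g : N (f - g) -> N g -> N f.
Proof. by move=> fg Ng; rewrite -(subrK g f); exact: subD. Qed.
Lemma sub_sum I (s : seq I) (P : pred I) (h : I -> T) :
  (forall i, P i -> N (h i)) -> N (\sum_(i <- s | P i) h i).
Proof. by move=> Nh; apply: (big_ind N) => //; [exact: sub0|exact: subD]. Qed.

Lemma sub_brUV p q (h : gen -> T) :
  (forall r, N (h (v_ r))) -> N (br (u_ p) (v_ q) h).
Proof. by move=> Nh; rewrite brUV; apply: subB; exact: subZ. Qed.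

Lemma sub_brUU p q (h : gen -> T) :
  (forall r, N (h (u_ r))) -> N (br (u_ p) (u_ q) h).
Proof. by move=> Nh; rewrite brUU; apply/subZ/subB => //; exact: subZ. Qed.

End Closure.

Lemma left_ideal_subspace N : left_ideal N -> subspace N.
Proof. by case. Qed.

Lemma left_ideal_lmul N x f : left_ideal N -> N f -> N (lmul x f).
Proof. by case=> _ _ _ _; apply. Qed.

Lemma subspace_preim N (X : T -> T) : linear X -> subspace N ->
  subspace (fun f => N (X f)).
Proof.
move=> lX Ns; have X0 : X 0 = 0.
  by have := lX (-1) 0 0; rewrite scaler0 add0r scaleN1r addNr.
split=> [|f g Nf Ng|a f Nf]; first by rewrite X0; exact: sub0.
  by rewrite -[f]scale1r lX scale1r; exact: subD.
by rewrite -[a *: f]addr0 lX X0 addr0; exact: subZ.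
Qed.

(** The span in impredicative form, so that membership is itself the induction principle for linear
    claims. *)
Definition spanw (P : word -> Prop) f := forall N, subspace N ->
  (forall w, P w -> N (basis_t K w)) -> N f.

Lemma spanw_sub P : subspace (spanw P).
Proof.
split=> [N /sub0//|f g hf hg N Ns NP|a f hf N Ns NP].
  by apply: (subD Ns); [exact: hf|exact: hg].
by apply: (subZ Ns); exact: hf.
Qed.

Lemma finsupp_left : left_ideal (@fin_supp K).
Proof.
split=> //.
- by exists [::] => w; rewrite /zero_t eqxx.
- move=> f g [s sP] [t tP]; exists (s ++ t) => w; rewrite mem_cat /add_t.
  apply: contra_neqT; rewrite negb_or => /andP[ws wt].
  have /eqP-> : f w == 0 by apply: contraNT ws; exact: sP.
  have /eqP-> : g w == 0 by apply: contraNT wt; exact: tP.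
  by rewrite addr0.
- move=> a f [s sP]; exists s => w afw; apply: sP; apply: contraNneq afw.
  by rewrite /scale_t => ->; rewrite mulr0.
- move=> x f [s sP]; exists [seq x :: w | w <- s] => -[|y w] /=; rewrite ?eqxx //.
  have [->|] := eqVneq y x; last by rewrite mul0r eqxx.
  by rewrite mul1r => /sP ws; exact: map_f.
Qed.

Lemma finsupp_spanw f : fin_supp f -> spanw (fun=> True) f.
Proof.
case=> s sP N Ns NP.
have -> : f = \sum_(w <- undup s) f w *: (basis_t K w : T).
  apply/funext => u; rewrite fct_sumE.
  have [us|us] := boolP (u \in s); last first.
    rewrite big1_seq; first by apply/eqP; apply: contraNT us; exact: sP.
    move=> w /=; rewrite mem_undup => ws; transitivity (f w * (u == w)%:R) => //.
    by case: eqP => [uw|]; rewrite ?mulr0 //; rewrite uw ws in us.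
  rewrite (bigD1_seq u) ?undup_uniq ?mem_undup //= big1 ?addr0.
    by transitivity (f u * (u == u)%:R) => //; rewrite eqxx mulr1.
  move=> w wu; transitivity (f w * (u == w)%:R) => //.
  by rewrite eq_sym (negbTE wu) mulr0.
by apply: sub_sum => // w _; apply: subZ => //; exact: NP.
Qed.

(* On the basis of words: the sum of all words obtained by deleting one
   occurrence of the letter [y]. *)
Fixpoint der y f w : K^o :=
  f (y :: w) + (if w is x :: w' then der y (fun u => f (x :: u)) w' else 0).

Lemma der_linear y : linear (der y).
Proof.
move=> a f g; apply/funext => w; elim: w f g => [|x w IH] f g;
  rewrite !fctE /=; first by rewrite !addr0.
rewrite scalerDr addrACA; congr (_ + _).
exact: (IH (fun u => f (x :: u)) (fun u => g (x :: u))).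
Qed.

Lemma der0 y : der y 0 = 0.
Proof.
by have := der_linear y (-1) 0 0; rewrite scaler0 add0r scaleN1r addNr.
Qed.

(** Leibniz rule; together with [der_nil] it computes [der] on every word. *)
Lemma der_lmul y x f : der y (lmul x f) = (x == y)%:R *: f + lmul x (der y f).
Proof.
apply/funext => -[|z w]; rewrite !fctE /=.
  by rewrite [y == x]eq_sym.
rewrite [y == x]eq_sym; congr (_ + _).
have -> : (fun u => (z == x)%:R * f u) = (z == x)%:R *: f + 0 by rewrite addr0.
by rewrite der_linear der0 addr0.
Qed.

Lemma der_nil y : der y (basis_t K [::]) = 0.
Proof.
apply/funext => -[|z w] /=; rewrite /basis_t ?addr0 // add0r.
by have := congr1 (fun f : T => f w) (der0 y).
Qed.

Lemma der_finsupp y f : fin_supp f -> fin_supp (der y f).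
Proof.
move=> /finsupp_spanw /(_ (fun f => fin_supp (der y f))); apply.
  by apply: (subspace_preim (der_linear y)); exact/left_ideal_subspace/finsupp_left.
elim=> [|x w IH] _; first by rewrite der_nil; case: finsupp_left.
rewrite -lmul_basis der_lmul; case: finsupp_left => _ _ hD hZ hl.
by apply: hD; [apply: hZ; exact: basis_finsupp|apply: hl; exact: IH].
Qed.

End Subspaces.

(** * Descent in the induced module *)

Ltac pointwise_ring :=
  apply/funext => ?; rewrite ?fctE /GRing.scale /=; ring.

Section InducedModule.
Variables (K : fieldType) (n : nat) (psi : gen -> K).
Local Notation T := (word -> K^o).
Implicit Types (f : T) (N : T -> Prop) (x y : gen) (w : word).
Local Notation e w := (basis_t K w : T).
Local Notation I := (ind_ideal n psi : T -> Prop).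

Lemma rel_finsupp r : ind_rel n psi r -> fin_supp r.
Proof.
have Fl := @finsupp_left K; have Fs := left_ideal_subspace Fl.
case=> [[x [y [w ->]]]|[x [_ ->]]].
  have -> : (fun u => basis_t K [:: x, y & w] u - basis_t K [:: y, x & w] u
      - lc_t (bracket K x y) w u) =
     e [:: x, y & w] - e [:: y, x & w] - br x y (fun g => e (g :: w)).
    by apply/funext => u; rewrite !fctE /lc_t /br fct_sumE.
  apply: (subB Fs); first by apply: (subB Fs); exact: basis_finsupp.
  by apply: (sub_sum Fs) => p _; apply: (subZ Fs); exact: basis_finsupp.
have -> : (fun u => basis_t K [:: x] u - psi x * basis_t K [::] u) =
   e [:: x] - psi x *: e [::] by [].
by apply: (subB Fs); [|apply: (subZ Fs)]; exact: basis_finsupp.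
Qed.

Lemma ind_ideal_left : left_ideal I.
Proof.
have Fl := @finsupp_left K; split.
- by move=> f; apply=> //; exact: rel_finsupp.
- by move=> S [].
- move=> f g If Ig S Sl Sr; case: (Sl) => _ _ SD _ _.
  by apply: SD; [exact: If|exact: Ig].
- by move=> a f If S Sl Sr; case: (Sl) => _ _ _ SZ _; apply: SZ; exact: If.
- by move=> x f If S Sl Sr; case: (Sl) => _ _ _ _ SM; apply: SM; exact: If.
Qed.
Let I_left := ind_ideal_left.
Let I_sub : subspace I := left_ideal_subspace ind_ideal_left.

Lemma ind_ideal_comm x y f : fin_supp f ->
  I (lmul x (lmul y f) - lmul y (lmul x f) - br x y (fun g => lmul g f)).
Proof.
pose X (f : T) : T := lmul x (lmul y f) - lmul y (lmul x f) - br x y (fun g => lmul g f).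
have lX : linear X.
  move=> a h k; rewrite /X !lmul_linear.
  have -> : br x y (fun g => lmul g (a *: h + k) : T) =
      a *: br x y (fun g => lmul g h : T) + br x y (fun g => lmul g k : T).
    by rewrite -brZ -brD; apply: br_ext => g; rewrite lmul_linear.
  pointwise_ring.
move=> /finsupp_spanw /(_ (fun f => I (X f))); apply; first exact: (subspace_preim lX).
move=> w _ S Sl Sr; apply: Sr; left; exists x, y, w; rewrite /X !lmul_basis.
apply/funext => u; rewrite !fctE /lc_t /br fct_sumE; congr (_ - _).
by apply: eq_bigr => p _; rewrite lmul_basis.
Qed.

(** The operator x - psi(x), which for x in F_n kills the generator; hence it acts on words through
    commutators only. *)
Definition shift x f : T := lmul x f - psi x *: f.

Lemma shift_linear x : linear (shift x).
Proof. by move=> a f g; rewrite /shift lmul_linear; pointwise_ring. Qed.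

Lemma ind_ideal_shift x : (n < x.2)%N -> I (shift x (e [::])).
Proof.
move=> nx S Sl Sr; apply: Sr; right; exists x; rewrite inFE; split=> //.
by rewrite /shift lmul_basis.
Qed.

Lemma left_ideal_shift (S : T -> Prop) x f : left_ideal S -> S f -> S (shift x f).
Proof.
move=> Sl Sf; have Ss := left_ideal_subspace Sl.
by apply: (subB Ss); [exact: left_ideal_lmul|exact: (subZ Ss)].
Qed.

(** The preimage in the tensor algebra of a span of words in M_psi. *)
Definition spanI (P : word -> Prop) f := forall N, subspace N ->
  (forall g, I g -> N g) -> (forall w, P w -> N (e w)) -> N f.

Section SpanI.
Variable P : word -> Prop.

Lemma spanI_sub : subspace (spanI P).
Proof.
split=> [N /sub0//|f g hf hg N Ns NI NP|a f hf N Ns NI NP].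
  by apply: (subD Ns); [exact: hf|exact: hg].
by apply: (subZ Ns); exact: hf.
Qed.

Lemma spanI_ideal f : I f -> spanI P f. Proof. by move=> If N _ NI _; exact: NI. Qed.

Lemma spanI_basis w : P w -> spanI P (e w). Proof. by move=> Pw N _ _; apply. Qed.

Lemma spanI_map N (X : T -> T) f : linear X -> subspace N ->
  (forall g, I g -> N (X g)) -> (forall w, P w -> N (X (e w))) ->
  spanI P f -> N (X f).
Proof.
by move=> lX Ns XI XP /(_ (fun f => N (X f))); apply=> //; exact: subspace_preim.
Qed.

(** The formal derivatives need not respect [I], so before differentiating an element is replaced by
    a representative that is a genuine combination of the allowed words. *)
Lemma spanI_spanw f : spanI P f -> exists g, spanw P g /\ I (f - g).
Proof.
move=> /(_ (fun f => exists g, spanw P g /\ I (f - g))); apply.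
- have Ps := @spanw_sub K P; split.
  + by exists 0; split; [exact: (sub0 Ps)|rewrite subrr; exact: (sub0 I_sub)].
  + move=> h k [h' [sh Ih]] [k' [sk Ik]]; exists (h' + k'); split; first exact: (subD Ps).
    by rewrite opprD addrACA; exact: (subD I_sub).
  + move=> a h [h' [sh Ih]]; exists (a *: h'); split; first exact: (subZ Ps).
    by rewrite -scalerBr; exact: (subZ I_sub).
- move=> g Ig; exists 0; rewrite subr0; split=> //; exact: (sub0 (@spanw_sub K P)).
- move=> w Pw; exists (e w); rewrite subrr; split; last exact: (sub0 I_sub).
  by move=> N _; apply.
Qed.

Lemma spanI_finsupp f : spanI P f -> fin_supp f.
Proof.
apply; first exact/left_ideal_subspace/finsupp_left; last by move=> w _; exact: basis_finsupp.
by case: I_left.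
Qed.
End SpanI.

Lemma spanI_mono (P Q : word -> Prop) f : (forall w, P w -> Q w) -> spanI P f -> spanI Q f.
Proof.
by move=> PQ; apply; [exact: spanI_sub|exact: spanI_ideal|move=> w /PQ; exact: spanI_basis].
Qed.

Lemma spanI_empty (P : word -> Prop) f : (forall w, ~ P w) -> spanI P f -> I f.
Proof. by move=> nP; apply=> // w /nP. Qed.

Lemma sum_kronecker b i (h : nat -> T) : (i <= n)%N ->
  \sum_(j < n.+1) (((b, i) : gen) == (b, j : nat))%:R *: h j = h i.
Proof.
move=> i_n; have i_n1 : (i < n.+1)%N by [].
rewrite (bigD1 (Ordinal i_n1)) //= eqxx scale1r big1 ?addr0 // => j ji.
have {}ji : (j : nat) != i by [].
by rewrite xpair_eqE eqxx /= eq_sym (negbTE ji) scale0r.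
Qed.

(** * Exchanging letters modulo a subspace containing the ideal *)

Section Commute.
Variables (N : T -> Prop) (N_sub : subspace N) (IN : forall f, I f -> N f).

Lemma lmul_swap x y f : fin_supp f -> N (br x y (fun g => lmul g f)) ->
  N (lmul x (lmul y f) - lmul y (lmul x f)).
Proof.
by move=> ff Nb; apply: (sub_trans N_sub) Nb; apply: IN; exact: ind_ideal_comm.
Qed.

Lemma lmul_comm x y f : fin_supp f -> N (br x y (fun g => lmul g f)) ->
  N (lmul y (lmul x f)) -> N (lmul x (lmul y f)).
Proof. by move=> ff Nb; apply: (sub_trans N_sub); exact: lmul_swap. Qed.

Lemma shift_swap x y f : fin_supp f -> N (br x y (fun g => lmul g f)) ->
  N (shift x (lmul y f) - lmul y (shift x f)).
Proof.
move=> ff Nb; have := lmul_swap ff Nb; congr N.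
by rewrite /shift lmulB lmulZ; pointwise_ring.
Qed.

Lemma shift_lmul x y f : fin_supp f -> N (br x y (fun g => lmul g f)) ->
  N (lmul y (shift x f)) -> N (shift x (lmul y f)).
Proof. by move=> ff Nb; apply: (sub_trans N_sub); exact: shift_swap. Qed.

End Commute.

(* The value of the letter [v_r] modulo terms of lower degree. *)
Definition hat x f : T := if (n < x.2)%N then psi x *: f else lmul x f.

Lemma hat_linear x : linear (hat x).
Proof.
move=> a f g; rewrite /hat; case: ifP => _; last exact: lmul_linear.
by rewrite scalerDr !scalerA mulrC.
Qed.

Lemma hatV_lmulV r s f : fin_supp f ->
  I (hat (v_ r) (lmul (v_ s) f) - lmul (v_ s) (hat (v_ r) f)).
Proof.
move=> ff; rewrite /hat; case: ifP => _.
  by rewrite lmulZ subrr; exact: (sub0 I_sub).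
by apply: (lmul_swap I_sub) => //; rewrite brVV; exact: (sub0 I_sub).
Qed.

(** The bracket [x,y] acting with its letters of index above n replaced by scalars: these operators
    are the entries of the matrix inverted below. *)
Definition hbr x y f : T := br x y (fun g => hat g f).

Lemma hbr_linear x y : linear (hbr x y).
Proof.
move=> a f h; rewrite /hbr -brZ -brD; apply: br_ext => g.
exact: hat_linear.
Qed.

Lemma hbr_lmulV p q s f : fin_supp f ->
  I (hbr (u_ p) (v_ q) (lmul (v_ s) f) - lmul (v_ s) (hbr (u_ p) (v_ q) f)).
Proof.
move=> ff; rewrite /hbr (br_linear _ _ _ (@lmul_linear K (v_ s))) -brB.
by apply: (sub_brUV I_sub) => r; exact: hatV_lmulV.
Qed.

Definition stableV N := forall r f, N f -> N (lmul (v_ r) f).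

Lemma hatV_stable N r f : subspace N -> stableV N -> N f -> N (hat (v_ r) f).
Proof.
by move=> Ns Nv Nf; rewrite /hat; case: ifP => _; [exact: (subZ Ns)|exact: Nv].
Qed.

Lemma hbr_stable N p q f : subspace N -> stableV N -> N f -> N (hbr (u_ p) (v_ q) f).
Proof. by move=> Ns Nv Nf; apply: (sub_brUV Ns) => r; exact: hatV_stable. Qed.

Lemma I_stableV : stableV I.
Proof. by move=> r f; exact: left_ideal_lmul. Qed.

(** * Solving the antitriangular system *)

Section Triangular.
Variables (charK0 : [pchar K] =i pred0) (D : nat).
Hypotheses (ltnD : (n < D)%N) (psiD : psi (v_ D) != 0).
Hypothesis psi_gtD : forall r, (D < r)%N -> psi (v_ r) = 0.

(** Forward substitution with q = D+1-j. Terms with i > j involve only v_r with r > D and vanish,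
    terms with i < j lie in [N] by induction, and the diagonal term is d_j times [c2 j q * psi v_D],
    which is nonzero. The bound 2n <= D ensures q > n. *)
Lemma triangular N (op : nat -> nat -> T -> T) (c1 c2 : nat -> nat -> K) (d : nat -> T) :
  subspace N -> stableV N ->
  (forall j q f, op j q f =
     c1 j q *: hat (v_ (j + q).+1) f + c2 j q *: hat (v_ (j + q).-1) f) ->
  (forall j q, (j <= n < q)%N -> c2 j q != 0) ->
  (forall q, (n < q)%N -> (D.+1 <= q + n)%N -> N (\sum_(j < n.+1) op j q (d j))) ->
  (2 * n <= D)%N ->
  forall j, (j <= n)%N -> N (d j).
Proof.
move=> Ns Nv opE c2_neq0 Nsum le_nD; elim/ltn_ind => j IH jn.
have jn1 : (j < n.+1)%N by [].
have hat0 r f : (D < r)%N -> hat (v_ r) f = 0.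
  by move=> Dr; rewrite /hat /= (ltn_trans ltnD Dr) psi_gtD // scale0r.
have : N (\sum_(i < n.+1) op i (D.+1 - j)%N (d i)) by apply: Nsum; lia.
rewrite (bigD1 (Ordinal jn1)) //= => Nop.
have {Nop} : N (op j (D.+1 - j)%N (d j)).
  rewrite -[op _ _ _](addrK (\sum_(i < n.+1 | i != Ordinal jn1) op i (D.+1 - j)%N (d i))).
  apply: (subB Ns) => //; apply: (sub_sum Ns) => i ij.
  have {}ij : (i : nat) != j by [].
  rewrite opE; have [lt_ij|le_ji] := ltnP i j.
    have Nd : N (d i) by apply: IH => //; lia.
    by apply: (subD Ns); apply: (subZ Ns); exact: hatV_stable.
  rewrite !hat0; [by rewrite !scaler0 addr0; exact: (sub0 Ns)|lia|lia].
have E : (j + (D.+1 - j)).-1 = D by lia.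
rewrite opE E hat0 ?scaler0 ?add0r; last lia.
rewrite /hat ltnD scalerA => Nd.
have c_neq0 : c2 j (D.+1 - j)%N * psi (v_ D) != 0.
  by rewrite mulf_neq0 // c2_neq0 //; lia.
by rewrite -(scalerK c_neq0 (d j)); exact: (subZ Ns).
Qed.

Lemma triangular_u N (d : nat -> T) : subspace N -> stableV N -> (2 * n <= D)%N ->
  (forall q, (n < q)%N -> (D.+1 <= q + n)%N ->
     N (\sum_(j < n.+1) hbr (u_ j) (v_ q) (d j))) ->
  forall j, (j <= n)%N -> N (d j).
Proof.
move=> Ns Nv le_nD Nsum.
apply: (@triangular N (fun j q => hbr (u_ j) (v_ q))
  (fun j q => j%:R - q%:R + 1) (fun j q => - (4 * (j%:R - q%:R)))) => // [j q f|j q jnq].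
  by rewrite /hbr brUV scaleNr.
by rewrite oppr_eq0 mulf_neq0 // ?(natK_eq0 charK0) // natB_neq0 //; lia.
Qed.

Lemma triangular_v N (d : nat -> T) : subspace N -> stableV N -> (2 * n <= D)%N ->
  (forall q, (n < q)%N -> (D.+1 <= q + n)%N ->
     N (\sum_(j < n.+1) hbr (u_ q) (v_ j) (d j))) ->
  forall j, (j <= n)%N -> N (d j).
Proof.
move=> Ns Nv le_nD Nsum.
apply: (@triangular N (fun j q => hbr (u_ q) (v_ j))
  (fun j q => q%:R - j%:R + 1) (fun j q => - (4 * (q%:R - j%:R)))) => // [j q f|j q jnq].
  by rewrite /hbr brUV scaleNr [(q + j)%N]addnC.
by rewrite oppr_eq0 mulf_neq0 // ?(natK_eq0 charK0) // natB_neq0 //; lia.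
Qed.
End Triangular.

(** * The filtration by the number of letters u *)

Definition wordVU (vs us : seq nat) : word :=
  [seq v_ i | i <- vs] ++ [seq u_ i | i <- us].

(** The strict bound makes [ufil 0] equal to [I]. The indices in [vs] are unrestricted, so each step
    is stable under all the [v]'s. *)
Definition ufil m := spanI (fun w => exists vs us,
  [/\ w = wordVU vs us, all (fun i => i <= n)%N us & (size us < m)%N]).

Lemma ufil_sub m : subspace (ufil m). Proof. exact: spanI_sub. Qed.

Lemma ufil_mono m m' f : (m <= m')%N -> ufil m f -> ufil m' f.
Proof.
move=> mm'; apply: spanI_mono => w [vs [us [-> us_n us_m]]].
by exists vs, us; split=> //; exact: leq_trans mm'.
Qed.

Lemma ufil_word m vs us : all (fun i => i <= n)%N us -> (size us < m)%N ->
  ufil m (e (wordVU vs us)).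
Proof. by move=> us_n us_m; apply: spanI_basis; exists vs, us. Qed.

Lemma ufil_ideal m f : I f -> ufil m f. Proof. exact: spanI_ideal. Qed.

Lemma ufil_finsupp m f : ufil m f -> fin_supp f. Proof. exact: spanI_finsupp. Qed.

Lemma ufil0 f : ufil 0 f -> I f.
Proof. by apply: spanI_empty => w [vs [us []]]. Qed.

Lemma ufil_stableV m : stableV (ufil m).
Proof.
move=> r f; apply: (spanI_map (@lmul_linear K _) (ufil_sub m)) => [h Ih|w].
  by apply: ufil_ideal; exact: (left_ideal_lmul _ I_left Ih).
by move=> [vs [us [-> us_n us_m]]]; rewrite lmul_basis; exact: (ufil_word (r :: vs)).
Qed.

Lemma ufil_lmul_low m i f : (i <= n)%N -> ufil m f -> ufil m.+1 (lmul (u_ i) f).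
Proof.
move=> i_n; apply: (spanI_map (@lmul_linear K _) (ufil_sub _)) => [h Ih|w].
  by apply: ufil_ideal; exact: (left_ideal_lmul _ I_left Ih).
case=> vs [us [-> us_n us_m]].
elim: vs => [|a vs IH].
  by rewrite lmul_basis; apply: (@ufil_word _ [::] (i :: us)) => //=; rewrite i_n.
rewrite -[wordVU _ _]/(v_ a :: wordVU vs us) -lmul_basis.
apply: (lmul_comm (ufil_sub _) (@ufil_ideal _) (basis_finsupp K _)).
  apply: (sub_brUV (ufil_sub _)) => r; apply: ufil_stableV.
  by apply: ufil_word => //; exact: ltnW.
by apply: ufil_stableV; exact: IH.
Qed.

Lemma ufil_lmul m j f : ufil m f -> ufil m.+1 (lmul (u_ j) f).
Proof.
apply: (spanI_map (@lmul_linear K _) (ufil_sub _)) => [h Ih|w].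
  by apply: ufil_ideal; exact: (left_ideal_lmul _ I_left Ih).
case=> vs [us [-> us_n us_m]].
(* The bound is tied to the exact number of [u]'s so that induction on [vs] and [us] applies. *)
suff {m us_m vs} base vs : ufil (size us).+2 (lmul (u_ j) (e (wordVU vs us))).
  by apply: ufil_mono (base vs).
elim: vs => [|a vs IH]; last first.
  rewrite -[wordVU _ _]/(v_ a :: wordVU vs us) -lmul_basis.
  apply: (lmul_comm (ufil_sub _) (@ufil_ideal _) (basis_finsupp K _)).
    by apply: (sub_brUV (ufil_sub _)) => r; apply: ufil_stableV; exact: ufil_word.
  by apply: ufil_stableV; exact: IH.
(* The index [j] must vary: exchanging [u_j] and [u_i] leaves letters [u_r] of other indices acting
   on the shorter word. *)
elim: us us_n j => [|i us IH] us_n j.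
  have [jn|nj] := leqP j n; first by apply: ufil_lmul_low => //; exact: ufil_word.
  rewrite -[lmul _ _](subrK (psi (u_ j) *: e [::])).
  apply: (subD (ufil_sub _)); first by apply: ufil_ideal; exact: ind_ideal_shift.
  by apply: (subZ (ufil_sub _)); exact: (@ufil_word _ [::] [::]).
have /andP[i_n {}us_n] := us_n.
rewrite -[wordVU _ _]/(u_ i :: wordVU [::] us) -lmul_basis.
apply: (lmul_comm (ufil_sub _) (@ufil_ideal _) (basis_finsupp K _)).
  by apply: (sub_brUU (ufil_sub _)) => r; apply: ufil_mono (IH us_n r).
by apply: ufil_lmul_low => //; exact: IH.
Qed.

(** On its way to the generator, where [shift] gives 0, [v_q] commutes with the [v]'s and each
    commutator with a [u] turns that [u] into [v]'s. *)
Lemma ufil_shiftV_word q vs us : (n < q)%N -> all (fun i => i <= n)%N us ->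
  ufil (size us) (shift (v_ q) (e (wordVU vs us))).
Proof.
move=> nq us_n; elim: vs => [|a vs IH]; last first.
  rewrite -[wordVU _ _]/(v_ a :: wordVU vs us) -lmul_basis.
  apply: (shift_lmul (ufil_sub _) (@ufil_ideal _) (basis_finsupp K _)).
    by rewrite brVV; exact: (sub0 (ufil_sub _)).
  exact: ufil_stableV.
elim: us us_n => [|i us IH]; first by move=> _; apply: ufil_ideal; exact: ind_ideal_shift.
case/andP=> i_n us_n; rewrite -[wordVU _ _]/(u_ i :: wordVU [::] us) -lmul_basis.
apply: (shift_lmul (ufil_sub _) (@ufil_ideal _) (basis_finsupp K _)).
  rewrite brVU; apply: (subN (ufil_sub _)); apply: (sub_brUV (ufil_sub _)) => r.
  by apply: ufil_stableV; exact: ufil_word.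
by apply: ufil_lmul_low => //; exact: IH.
Qed.

Lemma ufil_shiftV m q f : (n < q)%N -> ufil m.+1 f -> ufil m (shift (v_ q) f).
Proof.
move=> nq; apply: (spanI_map (@shift_linear _) (ufil_sub _)) => [h Ih|w].
  by apply: ufil_ideal; exact: (left_ideal_shift _ I_left Ih).
case=> vs [us [-> us_n us_m]].
by apply: ufil_mono (ufil_shiftV_word vs nq us_n).
Qed.

Lemma ufil_hatV m r f : ufil m.+1 f -> ufil m (lmul (v_ r) f - hat (v_ r) f).
Proof.
move=> mf; rewrite /hat; case: ifP => nr; first exact: ufil_shiftV.
by rewrite subrr; exact: (sub0 (ufil_sub _)).
Qed.

Lemma ufil_der m j vs us : all (fun i => i <= n)%N us -> (size us <= m)%N ->
  ufil m (der (u_ j) (e (wordVU vs us))).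
Proof.
move=> us_n; elim: vs m => [|a vs IH] m us_m; last first.
  rewrite -[wordVU _ _]/(v_ a :: wordVU vs us) -lmul_basis der_lmul.
  have -> : (v_ a == u_ j) = false by [].
  by rewrite scale0r add0r; apply: ufil_stableV; exact: IH.
elim: us us_n m us_m => [|i us IH] us_n m us_m.
  by rewrite der_nil; exact: (sub0 (ufil_sub _)).
have /andP[i_n {}us_n] := us_n; case: m us_m => // m us_m.
rewrite -[wordVU _ _]/(u_ i :: wordVU [::] us) -lmul_basis der_lmul.
apply: (subD (ufil_sub _)); first by apply: (subZ (ufil_sub _)); exact: ufil_word.
by apply: ufil_lmul_low => //; exact: IH.
Qed.

Lemma hbr_lmulU m p q i f : ufil m f ->
  ufil m (hbr (u_ p) (v_ q) (lmul (u_ i) f) - lmul (u_ i) (hbr (u_ p) (v_ q) f)).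
Proof.
move=> mf; rewrite /hbr (br_linear _ _ _ (@lmul_linear K (u_ i))) -brB.
apply: (sub_brUV (ufil_sub _)) => r; rewrite /hat; case: ifP => _.
  by rewrite lmulZ subrr; exact: (sub0 (ufil_sub _)).
apply: (lmul_swap (ufil_sub _) (@ufil_ideal _)); first exact: ufil_finsupp mf.
rewrite brVU; apply: (subN (ufil_sub _)); apply: (sub_brUV (ufil_sub _)) => t.
exact: ufil_stableV.
Qed.

(** Each [u_j] passed contributes [v_q, u_j] = -[u_j, v_q], whence the plus sign. Replacing the
    resulting [v]'s by their [hat] and moving them to the front costs only terms with still fewer
    [u]'s. *)
Lemma ufil_leading q vs us : (n < q)%N -> all (fun i => i <= n)%N us ->
  ufil (size us).-1 (shift (v_ q) (e (wordVU vs us)) +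
    \sum_(j < n.+1) hbr (u_ j) (v_ q) (der (u_ j) (e (wordVU vs us)))).
Proof.
move=> nq us_n; elim: vs => [|a vs IH]; last first.
  rewrite -[wordVU _ _]/(v_ a :: wordVU vs us) -lmul_basis.
  set f := e _ in IH *; have ff : fin_supp f by exact: basis_finsupp.
  apply: (sub_trans (ufil_sub _)) (ufil_stableV a IH); apply: ufil_ideal.
  rewrite lmulD lmul_sum opprD addrACA; apply: (subD I_sub).
    apply: (shift_swap I_sub) => //.
    by rewrite brVV; exact: (sub0 I_sub).
  rewrite -sumrB; apply: (sub_sum I_sub) => j _.
  have -> : der (u_ j) (lmul (v_ a) f) = lmul (v_ a) (der (u_ j) f).
    by rewrite der_lmul scale0r add0r.
  by apply: hbr_lmulV; exact: der_finsupp.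
elim: us us_n => [|i us IH].
  move=> _; apply: (subD (ufil_sub _)).
    by apply: ufil_ideal; exact: ind_ideal_shift.
  apply: (sub_sum (ufil_sub _)) => j _; rewrite der_nil.
  by apply: hbr_stable (ufil_sub _) (@ufil_stableV _) (sub0 (ufil_sub _)).
case/andP=> i_n us_n.
rewrite -[wordVU _ (i :: us)]/(u_ i :: wordVU [::] us) -lmul_basis.
set f := e _ in IH *; have ff : fin_supp f by exact: basis_finsupp.
have fm : ufil (size us).+1 f by exact: ufil_word.
have {IH} : ufil (size us) (lmul (u_ i) (shift (v_ q) f +
    \sum_(j < n.+1) hbr (u_ j) (v_ q) (der (u_ j) f))).
  (* For empty [us] the predecessor is truncated; the error then lies in [I], which is stable under
     [u_i]. *)
  have := IH us_n; case: (size us) => [/ufil0|m] B; last exact: ufil_lmul_low.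
  by apply: ufil_ideal; exact: (left_ideal_lmul _ ind_ideal_left B).
apply: (sub_trans (ufil_sub _)); rewrite lmulD lmul_sum /=.
have -> : \sum_(j < n.+1) hbr (u_ j) (v_ q) (der (u_ j) (lmul (u_ i) f)) =
   hbr (u_ i) (v_ q) f +
   \sum_(j < n.+1) hbr (u_ j) (v_ q) (lmul (u_ i) (der (u_ j) f)).
  rewrite -(sum_kronecker false (fun j => hbr (u_ j) (v_ q) f) i_n) -big_split.
  by apply: eq_bigr => j _; rewrite der_lmul hbr_linear.
set A := shift _ _; set B := hbr _ _ f; set C := lmul _ (shift _ _).
pose b := br (u_ i) (v_ q) (fun g => lmul g f : T).
(* Three errors: a defining relation, the passage from [v_r] to [hat], and the exchange of [hbr]
   with [u_i]. *)
rewrite [X in ufil _ X](_ : _ = (A - C - br (v_ q) (u_ i) (fun g => lmul g f : T)) - (b - B) +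
   (\sum_(j < n.+1) hbr (u_ j) (v_ q) (lmul (u_ i) (der (u_ j) f)) -
   \sum_(j < n.+1) lmul (u_ i) (hbr (u_ j) (v_ q) (der (u_ j) f)))); last first.
  by rewrite brVU -/b; pointwise_ring.
apply: (subD (ufil_sub _)).
  apply: (subB (ufil_sub _)).
    have := ind_ideal_comm (v_ q) (u_ i) ff.
    have -> : lmul (v_ q) (lmul (u_ i) f) - lmul (u_ i) (lmul (v_ q) f) = A - C.
      by rewrite /A /C /shift lmulB lmulZ; pointwise_ring.
    exact: ufil_ideal.
  by rewrite /b /B /hbr -brB; apply: (sub_brUV (ufil_sub _)) => r; exact: ufil_hatV.
rewrite -sumrB; apply: (sub_sum (ufil_sub _)) => j _.
by apply: hbr_lmulU; exact: (@ufil_der _ _ [::]).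
Qed.

(** * Euler's identity in the letters u *)

Section EulerU.
Definition eulerU f : T := \sum_(j < n.+1) lmul (u_ j) (der (u_ j) f).

Lemma eulerU_linear : linear eulerU.
Proof.
move=> a f h; rewrite /eulerU scaler_sumr -big_split; apply: eq_bigr => j _.
by rewrite der_linear lmul_linear.
Qed.

(** A deleted [u_j] is put back at the front; returning it to its place costs brackets [u,v] or
    [u,u], each of which loses one [u]. *)
Lemma eulerU_word vs us : all (fun i => i <= n)%N us ->
  ufil (size us) (eulerU (e (wordVU vs us)) - (size us)%:R *: e (wordVU vs us)).
Proof.
move=> us_n; elim: vs => [|a vs IH].
  elim: us us_n => [_|i us IH /andP[i_n us_n]].
    rewrite scale0r subr0; apply: (sub_sum (ufil_sub _)) => j _; rewrite der_nil.
    by apply: ufil_ideal; exact: (left_ideal_lmul _ ind_ideal_left (sub0 I_sub)).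
  rewrite -[wordVU _ (i :: us)]/(u_ i :: wordVU [::] us) -lmul_basis.
  set f := e _ in IH *; have ff : fin_supp f by exact: basis_finsupp.
  apply: (sub_trans (ufil_sub _)) (ufil_lmul_low i_n (IH us_n)).
  rewrite /= lmulB lmulZ -natr1 scalerDl scale1r.
  rewrite [X in ufil _ X](_ : _ = eulerU (lmul (u_ i) f) - lmul (u_ i) f - lmul (u_ i) (eulerU f));
    last by pointwise_ring.
  rewrite /eulerU.
  have -> : \sum_(j < n.+1) lmul (u_ j) (der (u_ j) (lmul (u_ i) f)) =
     lmul (u_ i) f + \sum_(j < n.+1) lmul (u_ j) (lmul (u_ i) (der (u_ j) f)).
    rewrite -[X in X + _](sum_kronecker false (fun j => lmul (u_ j) f) i_n).
    rewrite -big_split; apply: eq_bigr => j _.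
    by rewrite der_lmul lmulD lmulZ.
  rewrite [X in X - _]addrAC subrr add0r lmul_sum -sumrB.
  apply: (sub_sum (ufil_sub _)) => j _.
  apply: (lmul_swap (ufil_sub _) (@ufil_ideal _)); first exact: der_finsupp.
  apply: (sub_brUU (ufil_sub _)) => r; apply: ufil_lmul; exact: ufil_der.
rewrite -[wordVU _ us]/(v_ a :: wordVU vs us) -lmul_basis.
set f := e _ in IH *; have ff : fin_supp f by exact: basis_finsupp.
apply: (sub_trans (ufil_sub _)) (ufil_stableV a IH).
rewrite lmulB lmulZ opprB addrA subrK /eulerU lmul_sum -sumrB.
apply: (sub_sum (ufil_sub _)) => j _; rewrite der_lmul scale0r add0r.
apply: (lmul_swap (ufil_sub _) (@ufil_ideal _)); first exact: der_finsupp.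
by apply: (sub_brUV (ufil_sub _)) => r; apply: ufil_stableV; exact: ufil_der.
Qed.
End EulerU.

(** * Descent in the number of letters u *)

Section Descent.
Variables (charK0 : [pchar K] =i pred0) (D : nat).
Hypotheses (ltnD : (n < D)%N) (le_nD : (2 * n <= D)%N) (psiD : psi (v_ D) != 0).
Hypothesis psi_gtD : forall r, (D < r)%N -> psi (v_ r) = 0.

Lemma natr_cancel N m f : subspace N -> N (m.+1%:R *: f) -> N f.
Proof.
move=> Ns Nf; have m0 : m.+1%:R != 0 :> K by rewrite (natK_eq0 charK0).
by rewrite -(scalerK m0 f); exact: (subZ Ns).
Qed.

(** In terms of degree in the [u]'s: [h] has degree at most m+1, and the triangular system puts its
    derivatives in degree at most m-1 instead of m. So [eulerU h], which is (m+1) h up to degree m,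
    has degree at most m. *)
Lemma ufil_descent m f : ufil m.+2 f ->
  (forall q, (n < q)%N -> I (shift (v_ q) f)) -> ufil m.+1 f.
Proof.
move=> /spanI_spanw[h [sh Ifh]] If.
apply: (sub_trans (ufil_sub m.+1) (@ufil_ideal m.+1 _ Ifh)).
have Ih q : (n < q)%N -> I (shift (v_ q) h).
  move=> nq; have := subB I_sub (If q nq) (left_ideal_shift (v_ q) ind_ideal_left Ifh).
  by congr I; rewrite /shift lmulB; pointwise_ring.
have lead q : (n < q)%N -> ufil m (shift (v_ q) h +
     \sum_(j < n.+1) hbr (u_ j) (v_ q) (der (u_ j) h)).
  move=> nq; pose X (f : T) : T := shift (v_ q) f +
     \sum_(j < n.+1) hbr (u_ j) (v_ q) (der (u_ j) f).
  have lX : linear X.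
    move=> a k l; rewrite /X shift_linear.
    have -> : \sum_(j < n.+1) hbr (u_ j) (v_ q) (der (u_ j) (a *: k + l)) =
      a *: \sum_(j < n.+1) hbr (u_ j) (v_ q) (der (u_ j) k) +
      \sum_(j < n.+1) hbr (u_ j) (v_ q) (der (u_ j) l).
      rewrite scaler_sumr -big_split; apply: eq_bigr => j _.
      by rewrite der_linear hbr_linear.
    by rewrite addrACA -scalerDr.
  apply: (sh (fun f => ufil m (X f)) (subspace_preim lX (ufil_sub _))).
  move=> w [vs [us [-> us_n us_m]]].
  by apply: ufil_mono (ufil_leading vs nq us_n); lia.
have der_h j : (j <= n)%N -> ufil m (der (u_ j) h).
  apply: (triangular_u charK0 ltnD psiD psi_gtD (N := ufil m)
    (d := fun j => der (u_ j) h) (ufil_sub m) (@ufil_stableV m) le_nD).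
  move=> q nq _; rewrite -[X in ufil _ X](addKr (shift (v_ q) h)) addrC.
  by apply: (subB (ufil_sub _)); [exact: lead|apply: ufil_ideal; exact: Ih].
have eu_h : ufil m.+1 (eulerU h).
  apply: (sub_sum (ufil_sub _)) => j _; apply: ufil_lmul; apply: der_h.
  by rewrite -ltnS.
apply: (natr_cancel (m := m) (ufil_sub _)).
rewrite -[X in ufil _ X](subKr (eulerU h)); apply: (subB (ufil_sub _) eu_h).
pose X (f : T) : T := eulerU f - m.+1%:R *: f.
have lX : linear X.
  move=> a k l; rewrite /X eulerU_linear; pointwise_ring.
apply: (sh (fun f => ufil m.+1 (X f)) (subspace_preim lX (ufil_sub _))).
move=> w [vs [us [-> us_n us_m]]].
(* Words of exact degree m+1 satisfy Euler's identity with this factor; shorter words are already in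
   [ufil m.+1]. *)
have [eq_m|neq_m] := eqVneq (size us) m.+1.
  by rewrite /X -eq_m; exact: eulerU_word.
have le_m : (size us <= m)%N by move: us_m; rewrite ltnS leq_eqVlt (negbTE neq_m).
apply: (sub_trans (ufil_sub _) (g := ((size us)%:R - m.+1%:R) *: e (wordVU vs us))).
  have := ufil_mono (leqW le_m) (eulerU_word vs us_n); congr (ufil _).
  by rewrite /X scalerBl; pointwise_ring.
by apply: (subZ (ufil_sub _)); exact: ufil_word.
Qed.

End Descent.

(** * The weight filtration on words in the letters v *)

Definition wordV (vs : seq nat) : word := [seq v_ i | i <- vs].

(* [v_0] weighs [2], because [shift u_(n+1)] may replace it by [v_n]. *)
Definition wt (vs : seq nat) := sumn [seq (i == 0).+1 | i <- vs].

Definition vfil m := spanI (fun w => exists vs,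
  [/\ w = wordV vs, all (fun i => i <= n)%N vs & (wt vs < m)%N]).

Lemma vfil_sub m : subspace (vfil m). Proof. exact: spanI_sub. Qed.

Lemma vfil_mono m m' f : (m <= m')%N -> vfil m f -> vfil m' f.
Proof.
move=> mm'; apply: spanI_mono => w [vs [-> vs_n vs_m]].
by exists vs; split=> //; exact: leq_trans mm'.
Qed.

Lemma vfil_word m vs : all (fun i => i <= n)%N vs -> (wt vs < m)%N ->
  vfil m (e (wordV vs)).
Proof. by move=> vs_n vs_m; apply: spanI_basis; exists vs. Qed.

Lemma vfil_ideal m f : I f -> vfil m f. Proof. exact: spanI_ideal. Qed.

Lemma vfil0 f : vfil 0 f -> I f.
Proof. by apply: spanI_empty => w [vs []]. Qed.

Lemma vfil_lmul m i f : (i <= n)%N -> vfil m f -> vfil (m + (i == 0).+1) (lmul (v_ i) f).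
Proof.
move=> i_n; apply: (spanI_map (@lmul_linear K _) (vfil_sub _)) => [h Ih|w].
  by apply: vfil_ideal; exact: (left_ideal_lmul _ ind_ideal_left Ih).
case=> vs [-> vs_n vs_m]; rewrite lmul_basis; apply: (@vfil_word _ (i :: vs)).
  by rewrite /= i_n.
by rewrite /wt /= addnC ltn_add2r.
Qed.

Lemma shift_wordV q vs : (n < q)%N -> I (shift (v_ q) (e (wordV vs))).
Proof.
move=> nq; elim: vs => [|a vs IH]; first exact: ind_ideal_shift.
rewrite -[wordV _]/(v_ a :: wordV vs) -lmul_basis.
apply: (shift_lmul I_sub) => //; first exact: basis_finsupp.
  by rewrite brVV; exact: (sub0 I_sub).
exact: I_stableV.
Qed.

Lemma hat_wordV r vs : I (lmul (v_ r) (e (wordV vs)) - hat (v_ r) (e (wordV vs))).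
Proof.
rewrite /hat; case: ifP => nr; first exact: shift_wordV.
by rewrite subrr; exact: (sub0 I_sub).
Qed.

Lemma vfil_exhaust f : ufil 1 f -> exists m, vfil m f.
Proof.
move=> /(_ (fun f => exists m, vfil m f)); apply.
- split=> [|h k [m mh] [m' mk]|a h [m mh]]; first by exists 0%N; exact: (sub0 (vfil_sub _)).
    exists (maxn m m'); apply: (subD (vfil_sub _)).
      by apply: vfil_mono mh; exact: leq_maxl.
    by apply: vfil_mono mk; exact: leq_maxr.
  by exists m; exact: (subZ (vfil_sub _)).
- by move=> h Ih; exists 0%N; exact: vfil_ideal.
move=> w [vs [us [-> _]]]; rewrite ltnS leqn0 => /nilP ->; rewrite /wordVU cats0.
rewrite -/(wordV vs); elim: vs => [|a vs [m IH]].
  by exists 1%N; exact: (@vfil_word _ [::]).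
rewrite -[wordV _]/(v_ a :: wordV vs) -lmul_basis.
have [a_n|n_a] := leqP a n.
  by exists (m + (a == 0).+1)%N; exact: vfil_lmul.
exists m; apply: (sub_trans (vfil_sub m) (g := psi (v_ a) *: e (wordV vs))).
  by apply: vfil_ideal; exact: shift_wordV.
exact: (subZ (vfil_sub _)).
Qed.

(** Unlike [ufil_leading], this is exact modulo [I]: the brackets consist of [v]'s, which commute
    and act on words in the [v]'s exactly as their [hat]. *)
Lemma vfil_leading q vs : all (fun i => i <= n)%N vs -> (n < q)%N ->
  I (shift (u_ q) (e (wordV vs)) -
     \sum_(j < n.+1) hbr (u_ q) (v_ j) (der (v_ j) (e (wordV vs)))).
Proof.
move=> vs_n nq; elim: vs vs_n => [|i vs IH].
  move=> _; apply: (subB I_sub); first exact: ind_ideal_shift.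
  apply: (sub_sum I_sub) => j _; rewrite der_nil.
  exact: (hbr_stable _ _ I_sub I_stableV (sub0 I_sub)).
case/andP=> i_n vs_n; rewrite -[wordV _]/(v_ i :: wordV vs) -lmul_basis.
have := left_ideal_lmul (v_ i) ind_ideal_left (IH vs_n).
have hatI := hat_wordV ^~ vs.
set f := e _ in hatI *; have ff : fin_supp f by exact: basis_finsupp.
apply: (sub_trans I_sub); rewrite lmulB lmul_sum.
have -> : \sum_(j < n.+1) hbr (u_ q) (v_ j) (der (v_ j) (lmul (v_ i) f)) =
   hbr (u_ q) (v_ i) f +
   \sum_(j < n.+1) hbr (u_ q) (v_ j) (lmul (v_ i) (der (v_ j) f)).
  rewrite -(sum_kronecker true (fun j => hbr (u_ q) (v_ j) f) i_n) -big_split.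
  by apply: eq_bigr => j _; rewrite der_lmul hbr_linear.
pose A := lmul (u_ q) (lmul (v_ i) f) - lmul (v_ i) (lmul (u_ q) f).
pose b := br (u_ q) (v_ i) (fun g => lmul g f : T).
rewrite [X in I X](_ : _ = (A - b) + (b - hbr (u_ q) (v_ i) f) -
   (\sum_(j < n.+1) hbr (u_ q) (v_ j) (lmul (v_ i) (der (v_ j) f)) -
   \sum_(j < n.+1) lmul (v_ i) (hbr (u_ q) (v_ j) (der (v_ j) f)))); last first.
  by rewrite /A /shift lmulB lmulZ; pointwise_ring.
apply: (subB I_sub).
  apply: (subD I_sub); first exact: ind_ideal_comm.
  by rewrite /b /hbr -brB; apply: (sub_brUV I_sub) => r; exact: hatI.
rewrite -sumrB; apply: (sub_sum I_sub) => j _; apply: hbr_lmulV.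
exact: der_finsupp.
Qed.

(** The factor is the weight of [v_j], so that modulo [I] a word is an eigenvector with eigenvalue
    [wt]. *)
Definition eulerV f : T := \sum_(j < n.+1) (j == 0 :> nat).+1%:R *: lmul (v_ j) (der (v_ j) f).

Lemma eulerV_linear : linear eulerV.
Proof.
move=> a f h; rewrite /eulerV scaler_sumr -big_split; apply: eq_bigr => j _.
by rewrite der_linear lmul_linear scalerDr !scalerA mulrC.
Qed.

Lemma eulerV_word vs : all (fun i => i <= n)%N vs ->
  I (eulerV (e (wordV vs)) - (wt vs)%:R *: e (wordV vs)).
Proof.
elim: vs => [_|i vs IH /andP[i_n vs_n]].
  rewrite scale0r subr0; apply: (sub_sum I_sub) => j _; rewrite der_nil.
  apply: (subZ I_sub); exact: (left_ideal_lmul _ ind_ideal_left (sub0 I_sub)).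
rewrite -[wordV (i :: vs)]/(v_ i :: wordV vs) -lmul_basis.
have := left_ideal_lmul (v_ i) ind_ideal_left (IH vs_n).
set f := e _; have ff : fin_supp f by exact: basis_finsupp.
apply: (sub_trans I_sub); rewrite lmulB lmulZ.
have -> : eulerV (lmul (v_ i) f) = (i == 0).+1%:R *: lmul (v_ i) f +
   \sum_(j < n.+1) (j == 0 :> nat).+1%:R *: lmul (v_ j) (lmul (v_ i) (der (v_ j) f)).
  rewrite -(sum_kronecker true (fun j => (j == 0).+1%:R *: lmul (v_ j) f) i_n).
  rewrite -big_split; apply: eq_bigr => j _.
  by rewrite der_lmul lmulD lmulZ scalerDr !scalerA mulrC.
have -> : (wt (i :: vs))%:R = (i == 0).+1%:R + (wt vs)%:R :> K by rewrite -natrD.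
rewrite scalerDl /eulerV lmul_sum.
set A := _ *: lmul _ f; set B := _ *: lmul _ f.
set s1 := \sum_(j < _) _; set s2 := \sum_(j < _) _.
rewrite [X in I X](_ : _ = s1 - s2); last by pointwise_ring.
rewrite /s1 /s2 -sumrB; apply: (sub_sum I_sub) => j _.
rewrite lmulZ -scalerBr; apply: (subZ I_sub); apply: (lmul_swap I_sub) => //.
  exact: der_finsupp.
by rewrite brVV; exact: (sub0 I_sub).
Qed.

(** A commutator turns [v_i] into [v]'s of larger index, mostly above n and hence scalars. The bound
    D < q + n excludes n = 0, q = 1, where [u_1, v_0] contains v_0 itself. *)
Lemma vfil_shiftU_word D q vs : (n < D)%N -> (n < q)%N -> (D.+1 <= q + n)%N ->
  all (fun i => i <= n)%N vs -> vfil (wt vs) (shift (u_ q) (e (wordV vs))).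
Proof.
move=> nD nq qD; elim: vs => [_|i vs IH /andP[i_n vs_n]].
  by apply: vfil_ideal; exact: ind_ideal_shift.
rewrite -[wordV (i :: vs)]/(v_ i :: wordV vs) -lmul_basis.
have -> : wt (i :: vs) = (wt vs + (i == 0).+1)%N by rewrite addnC.
apply: (shift_lmul (vfil_sub _) (@vfil_ideal _) (basis_finsupp K _)).
  have high r : (n < r)%N -> vfil (wt vs + (i == 0).+1) (lmul (v_ r) (e (wordV vs))).
    move=> nr; apply: (sub_trans (vfil_sub _) (g := psi (v_ r) *: e (wordV vs))).
      by apply: vfil_ideal; exact: shift_wordV.
    by apply: (subZ (vfil_sub _)); apply: vfil_word => //; rewrite addnS ltnS leq_addr.
  rewrite brUV; apply: (subB (vfil_sub _)); apply: (subZ (vfil_sub _)).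
    by apply: high; lia.
  have [r_n|/high//] := leqP (q + i).-1 n.
  (* The one index not above n is n itself, from i = 0 and q = n+1. Then n < D <= 2n gives n > 0, so
     v_n has weight 1 and v_0 weight 2. *)
  have [i0 q_n n0] : [/\ i = 0, q = n.+1 & n != 0]%N by split; lia.
  rewrite i0 q_n addn0 /= lmul_basis; apply: (@vfil_word _ (n :: vs)) => /=.
    by rewrite leqnn.
  by rewrite /wt /= (negbTE n0); lia.
by apply: vfil_lmul => //; exact: IH.
Qed.

Lemma vfil_shiftU D m q f : (n < D)%N -> (n < q)%N -> (D.+1 <= q + n)%N ->
  vfil m.+1 f -> vfil m (shift (u_ q) f).
Proof.
move=> nD nq qD; apply: (spanI_map (@shift_linear _) (vfil_sub _)) => [h Ih|w].
  by apply: vfil_ideal; exact: (left_ideal_shift _ ind_ideal_left Ih).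
case=> vs [-> vs_n vs_m].
by apply: vfil_mono (vfil_shiftU_word nD nq qD vs_n).
Qed.

(** * Descent in weight, and simplicity *)

Section DescentV.
Variables (charK0 : [pchar K] =i pred0) (D : nat).
Hypotheses (ltnD : (n < D)%N) (le_nD : (2 * n <= D)%N) (psiD : psi (v_ D) != 0).
Hypothesis psi_gtD : forall r, (D < r)%N -> psi (v_ r) = 0.

(** As the leading formula is exact, the derivatives of [h] lie in [I]; then so does [eulerV h], and
    the part of top weight must vanish. *)
Lemma vfil_descent m f : vfil m.+2 f ->
  (forall q, (n < q)%N -> (D.+1 <= q + n)%N -> I (shift (u_ q) f)) -> vfil m.+1 f.
Proof.
move=> /spanI_spanw[h [sh Ifh]] If.
apply: (sub_trans (vfil_sub m.+1) (@vfil_ideal m.+1 _ Ifh)).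
have Ih q : (n < q)%N -> (D.+1 <= q + n)%N -> I (shift (u_ q) h).
  move=> nq qD; have := subB I_sub (If q nq qD) (left_ideal_shift (u_ q) ind_ideal_left Ifh).
  by congr I; rewrite /shift lmulB; pointwise_ring.
have lead q : (n < q)%N -> I (shift (u_ q) h -
     \sum_(j < n.+1) hbr (u_ q) (v_ j) (der (v_ j) h)).
  move=> nq; pose X (f : T) : T := shift (u_ q) f -
     \sum_(j < n.+1) hbr (u_ q) (v_ j) (der (v_ j) f).
  have lX : linear X.
    move=> a k l; rewrite /X shift_linear.
    have -> : \sum_(j < n.+1) hbr (u_ q) (v_ j) (der (v_ j) (a *: k + l)) =
      a *: \sum_(j < n.+1) hbr (u_ q) (v_ j) (der (v_ j) k) +
      \sum_(j < n.+1) hbr (u_ q) (v_ j) (der (v_ j) l).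
      rewrite scaler_sumr -big_split; apply: eq_bigr => j _.
      by rewrite der_linear hbr_linear.
    by rewrite opprD addrACA -scalerBr.
  apply: (sh (fun f => I (X f)) (subspace_preim lX I_sub)).
  by move=> w [vs [-> vs_n _]]; exact: vfil_leading.
have der_h j : (j <= n)%N -> I (der (v_ j) h).
  apply: (triangular_v charK0 ltnD psiD psi_gtD (N := I)
    (d := fun j => der (v_ j) h) I_sub I_stableV le_nD) => q nq qD.
  by have := subB I_sub (Ih q nq qD) (lead q nq); rewrite subKr.
have eu_h : I (eulerV h).
  apply: (sub_sum I_sub) => j _; apply: (subZ I_sub); apply: I_stableV; apply: der_h.
  by rewrite -ltnS.
apply: (natr_cancel charK0 (m := m) (vfil_sub _)).
rewrite -[X in vfil _ X](subKr (eulerV h)).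
apply: (subB (vfil_sub _)); first exact: vfil_ideal.
pose X (f : T) : T := eulerV f - m.+1%:R *: f.
have lX : linear X by move=> a k l; rewrite /X eulerV_linear; pointwise_ring.
apply: (sh (fun f => vfil m.+1 (X f)) (subspace_preim lX (vfil_sub _))).
move=> w [vs [-> vs_n vs_m]].
apply: (sub_trans (vfil_sub _) (g := ((wt vs)%:R - m.+1%:R) *: e (wordV vs))).
  have := @vfil_ideal m.+1 _ (eulerV_word vs_n); congr (vfil _).
  by rewrite /X scalerBl; pointwise_ring.
have [->|neq_m] := eqVneq (wt vs) m.+1.
  by rewrite subrr scale0r; exact: (sub0 (vfil_sub _)).
apply: (subZ (vfil_sub _)); apply: vfil_word => //.
by move: vs_m; rewrite ltnS leq_eqVlt (negbTE neq_m).
Qed.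

(** Either some [shift x f] is outside [I], and it stays in [S] one step lower, or all of them lie
    in [I] and [fil_desc] lowers [f] itself. *)
Lemma descent (S : T -> Prop) (fil : nat -> T -> Prop) (X : pred gen) :
  left_ideal S -> (forall f, fil 0%N f -> I f) ->
  (forall m f x, X x -> fil m.+1 f -> fil m (shift x f)) ->
  (forall m f, fil m.+2 f -> (forall x, X x -> I (shift x f)) -> fil m.+1 f) ->
  forall m f, S f -> ~ I f -> fil m f -> exists h, [/\ S h, ~ I h & fil 1%N h].
Proof.
move=> Sl fil0 filS fil_desc; elim=> [|m IH] f Sf nIf ff; first by case: nIf; exact: fil0.
case: m IH ff => [|m] IH ff; first by exists f.
have [[x [Xx nIx]]|nex] := pselect (exists x, X x /\ ~ I (shift x f)).
  by apply: (IH (shift x f)) => //; [exact: left_ideal_shift|exact: filS].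
apply: (IH f) => //; apply: fil_desc => // x Xx.
by apply: contrapT => nIx; apply: nex; exists x.
Qed.

Lemma ufil_exhaust f : fin_supp f -> exists m, ufil m f.
Proof.
move=> /finsupp_spanw /(_ (fun f => exists m, ufil m f)); apply.
- split=> [|h k [m mh] [m' mk]|a h [m mh]]; first by exists 0%N; exact: (sub0 (ufil_sub _)).
    exists (maxn m m'); apply: (subD (ufil_sub _)).
      by apply: ufil_mono mh; exact: leq_maxl.
    by apply: ufil_mono mk; exact: leq_maxr.
  by exists m; exact: (subZ (ufil_sub _)).
elim=> [|[[] p] w IH] _; first by exists 1%N; exact: (@ufil_word _ [::] [::]).
  by have [m IHm] := IH Logic.I; exists m; rewrite -lmul_basis; exact: ufil_stableV.
by have [m IHm] := IH Logic.I; exists m.+1; rewrite -lmul_basis; exact: ufil_lmul.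
Qed.

Lemma vfil1 f : vfil 1 f -> exists c, I (f - c *: e [::]).
Proof.
move=> /(_ (fun f => exists c, I (f - c *: e [::]))); apply.
- split=> [|h k [c Ih] [c' Ik]|a h [c Ih]].
  + by exists 0; rewrite scale0r subrr; exact: (sub0 I_sub).
  + exists (c + c'); rewrite scalerDl opprD addrACA; exact: (subD I_sub).
  + by exists (a * c); rewrite -scalerA -scalerBr; exact: (subZ I_sub).
- by move=> h Ih; exists 0; rewrite scale0r subr0.
move=> w [[|i vs] [-> _ //]] _; exists 1.
by rewrite scale1r subrr; exact: (sub0 I_sub).
Qed.

Lemma nondegenerate_simple (S : T -> Prop) f : left_ideal S ->
  (forall h, I h -> S h) -> S f -> ~ I f -> forall h, fin_supp h -> S h.
Proof.
move=> Sl IS Sf nIf; have Ss := left_ideal_subspace Sl.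
have [m fm] : exists m, ufil m f by apply: ufil_exhaust; case: Sl => + _ _ _ _; apply.
have shiftV k h x : x.1 && (n < x.2)%N -> ufil k.+1 h -> ufil k (shift x h).
  by case: x => -[] q //= nq; exact: ufil_shiftV.
have descV k h : ufil k.+2 h ->
    (forall x, x.1 && (n < x.2)%N -> I (shift x h)) -> ufil k.+1 h.
  move=> hk Ih; apply: (ufil_descent charK0 ltnD le_nD psiD psi_gtD hk) => q nq.
  exact: Ih.
have [f1 [Sf1 nIf1 /vfil_exhaust[{fm}m f1m]]] := descent Sl ufil0 shiftV descV Sf nIf fm.
(* Only these [u_q] lower the weight for certain, and they suffice for the triangular system. *)
pose X x := [&& ~~ x.1, n < x.2 & D < x.2 + n]%N.
have shiftU k h x : X x -> vfil k.+1 h -> vfil k (shift x h).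
  by rewrite /X; case: x => -[] q //= /andP[nq qD]; exact: (vfil_shiftU ltnD nq qD).
have descU k h : vfil k.+2 h -> (forall x, X x -> I (shift x h)) -> vfil k.+1 h.
  move=> hk Ih; apply: (vfil_descent hk) => q nq qD; apply: Ih.
  by rewrite /X /= nq.
have [f2 [Sf2 nIf2 /vfil1[c Ifc]]] := descent Sl vfil0 shiftU descU Sf1 nIf1 f1m.
have c0 : c != 0.
  by apply/eqP => c0; apply: nIf2; move: Ifc; rewrite c0 scale0r subr0.
have S1 : S (e [::]).
  rewrite -(scalerK c0 (e [::])); apply: (subZ Ss).
  by rewrite -[_ *: _](subKr f2); apply: (subB Ss) => //; exact: IS.
move=> h /finsupp_spanw; apply=> //; elim=> [//|x w IH] _.
by rewrite -lmul_basis; apply: left_ideal_lmul => //; exact: IH.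
Qed.

End DescentV.
End InducedModule.

(** * The theorem *)

Lemma nondegenerate_irreducible (K : fieldType) (charK0 : [pchar K] =i pred0)
  (n : nat) (psi : gen -> K) (psi_hom : is_lie_hom n psi) D :
  (n < D)%N -> (2 * n <= D)%N -> psi (v_ D) != 0 ->
  (forall r, (D < r)%N -> psi (v_ r) = 0) -> Mpsi_irreducible n psi.
Proof.
move=> nD n2D psiD psi_gtD; split.
  exists (basis_t K [::]); split; first exact: basis_finsupp.
  pose above (x : gen) := (n < x.2)%N.
  move=> /(_ (pbw_ideal above (psi : gen -> K^o)) (pbw_ideal_left _ _)) h.
  apply: (@pbw_ideal_normal K above psi [::]) => //; apply: h => r.
  apply: (@pbw_ideal_ind K above psi (@above_closed K n) (psi_br psi_hom)) => x.
  by rewrite inFE.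
move=> S Sl IS; have [SI|nSI] := pselect (forall f, S f -> ind_ideal n psi f).
  by left.
right; have [f [Sf nIf]] : exists f, S f /\ ~ ind_ideal n psi f.
  by apply: contrapT => nex; apply: nSI => f Sf; apply: contrapT => nIf; apply: nex; exists f.
exact: (nondegenerate_simple charK0 nD n2D psiD psi_gtD Sl IS Sf nIf).
Qed.

Theorem theorem6p29 (K : fieldType) (charK0 : [pchar K] =i pred0)
  (n : nat) (psi : gen -> K) (psi_hom : is_lie_hom n psi) :
  ((n = 0)%N -> (Mpsi_irreducible n psi <-> psi (Vb 0) != 0)) /\
  ((1 <= n)%N -> (Mpsi_irreducible n psi <->
                   psi (Vb (2 * n)%:Z) != 0 \/ psi (Vb (2 * n - 1)%:Z) != 0)).

Proof.
have psi_gt := psi_V_eq0 charK0 psi_hom.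
split=> [n0|n_gt0].
  (* For n = 0 the condition D > n leaves only D = 1, that is V_0. *)
  subst n; rewrite -[Vb 0]/(v_ 1); split=> [irr|psi1].
    apply/negP => /eqP psi1; move: irr; apply: (degenerate_reducible psi_hom).
    by move=> [|[|r]] // _ _; exact: psi_gt.
  by apply: (nondegenerate_irreducible charK0 psi_hom (D := 1)) => // r; exact: psi_gt.
have -> : Vb (2 * n)%:Z = v_ (2 * n + 1) by rewrite /Vb; congr (_, _); lia.
have -> : Vb (2 * n - 1)%:Z = v_ (2 * n) by rewrite /Vb; congr (_, _); lia.
(* D = 2n+1 is tried first, because the descent needs [psi] to vanish on every v_r beyond D. *)
have [psi1|psi1] := eqVneq (psi (v_ (2 * n + 1))) 0; last first.
  split=> _; first by left.
  by apply: (nondegenerate_irreducible charK0 psi_hom _ _ psi1) => //; lia.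
have psi_gt2 r : (2 * n < r)%N -> psi (v_ r) = 0.
  rewrite leq_eqVlt => /orP[/eqP<-|r_gt]; first by rewrite -addn1.
  by apply: psi_gt; rewrite addn1.
have [psi2|psi2] := eqVneq (psi (v_ (2 * n))) 0; last first.
  split=> _; first by right.
  by apply: (nondegenerate_irreducible charK0 psi_hom _ _ psi2) => //; lia.
split=> [irr|[]//]; exfalso; move: irr; apply: (degenerate_reducible psi_hom).
by move=> r _; rewrite leq_eqVlt => /orP[/eqP<-//|/psi_gt2].
Qed.
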